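(* Let $k$ be a field and let $R$ and $S$ be left noetherian $k$-algebras with $\dim_k(R)<|k|$ and $\dim_k(S)<|k|$. Suppose that there is an isomorphism of posets (a bijection which, together with its inverse, preserves inclusions) between the set of prime ideals of $R$ and the set of prime ideals of $S$, both ordered by inclusion. Then $R$ satisfies the Dixmier-Moeglin equivalence if and only if $S$ satisfies the Dixmier-Moeglin equivalence. In particular, if $\mathrm{Spec}(R)$ and $\mathrm{Spec}(S)$ are homeomorphic, then $R$ satisfies the Dixmier-Moeglin equivalence if and only if $S$ does.
   Context: Algebras are associative and unital; $|k|$ is the cardinality of $k$, and dimensions are compared with it as cardinals. $\mathrm{Spec}(R)$ is the set of (two-sided) prime ideals of $R$ with the Zariski topology, whose closed sets are the sets $\{P : P\supseteq I\}$ for $I$ a two-sided ideal. For a left noetherian $k$-algebra $R$ and $P\in\mathrm{Spec}(R)$: $P$ is locally closed if $\{P\}$ is a locally closed subset of $\mathrm{Spec}(R)$ (equivalently, $P$ is not equal to the intersection of all prime ideals properly containing $P$, where an empty intersection is $R$); $P$ is primitive if it is the annihilator of a simple left $R$-module; $P$ is rational if the centre $Z(Q(R/P))$ of the Goldie ring of quotients $Q(R/P)$ of $R/P$ is an algebraic extension of $k$. The left noetherian $k$-algebra $R$ satisfies the Dixmier-Moeglin equivalence if for every $P\in \mathrm{Spec}(R)$ the three properties ''locally closed'', ''primitive'' and ''rational'' are equivalent. *)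

(* Defs.v *)
From HB Require Import structures.
From mathcomp Require Import all_boot all_order all_algebra.
From mathcomp Require Import generic_quotient.
From mathcomp Require Import all_classical.
From mathcomp Require Import topology_structure.

Set Implicit Arguments.
Unset Strict Implicit.
Unset Printing Implicit Defensive.

Import GRing.Theory.
Local Open Scope ring_scope.
Local Open Scope quotient_scope.
Local Open Scope classical_set_scope.
Local Open Scope card_scope.

Section Ideals.
Context (R : nzRingType).
Implicit Types I J P : set R.

Definition left_ideal I :=
  [/\ I 0, forall x y, I x -> I y -> I (x + y) & forall r x, I x -> I (r * x)].

Definition two_sided_ideal I :=
  left_ideal I /\ forall x r, I x -> I (x * r).

Definition prime_ideal P :=
  [/\ two_sided_ideal P, ~ P 1 &
      forall I J, two_sided_ideal I -> two_sided_ideal J ->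
        (forall x y, I x -> J y -> P (x * y)) -> I `<=` P \/ J `<=` P].

Definition left_noetherian :=
  forall I : nat -> set R, (forall n, left_ideal (I n)) ->
    (forall n, I n `<=` I n.+1) ->
    exists N, forall n, (N <= n)%N -> I n = I N.

End Ideals.

Record spec (R : nzRingType) := Spec {
  spec_ideal :> set R;
  spec_prime : prime_ideal spec_ideal }.

HB.instance Definition _ (R : nzRingType) := gen_eqMixin (spec R).
HB.instance Definition _ (R : nzRingType) := gen_choiceMixin (spec R).

Section Zariski.
Context (R : nzRingType).

Definition zariski_open (U : set (spec R)) :=
  exists2 I : set R, two_sided_ideal I & ~` U = [set P : spec R | I `<=` P].

Let zariski_openT : zariski_open setT.
Proof.
exists setT; first by do !split.
rewrite setCT; apply/seteqP; split=> // P /= RP.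
by case: (spec_prime P) => _ + _; apply; apply: RP.
Qed.

Let zariski_openI : setI_closed zariski_open.
Proof.
move=> U V [I idI UI] [J idJ VJ]; exists (I `&` J).
  case: idI idJ => [[I0 ID IM] IMr] [[J0 JD JM] JMr].
  split; first split=> //.
  - by move=> x y [Ix Jx] [Iy Jy]; split; [apply: ID|apply: JD].
  - by move=> r x [Ix Jx]; split; [apply: IM|apply: JM].
  - by move=> x r [Ix Jx]; split; [apply: IMr|apply: JMr].
rewrite setCI UI VJ; apply/seteqP; split=> P /=.
  by move=> [IP|JP] x [Ix Jx]; [apply: IP|apply: JP].
move=> IJP; case: (spec_prime P) => _ _; apply=> // x y Ix Jy.
by apply: IJP; split; [apply: idI.2|case: idJ => -[_ _ +] _; apply].
Qed.

Let zariski_open_bigU (X : Type) (f : X -> set (spec R)) :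
  (forall i, zariski_open (f i)) -> zariski_open (\bigcup_i f i).
Proof.
move=> fo; pose J i : set R := sval (cid2 (fo i)).
have JE i : ~` f i = [set P : spec R | J i `<=` P].
  by rewrite /J; case: cid2.
exists [set x | forall I, two_sided_ideal I -> (forall i, J i `<=` I) -> I x].
  split; first split.
  - by move=> I [[]].
  - move=> x y Kx Ky I idI JI; have [[_ ID _] _] := idI.
    by apply: ID; [apply: Kx|apply: Ky].
  - move=> r x Kx I idI JI; have [[_ _ IM] _] := idI.
    by apply: IM; apply: Kx.
  - move=> x r Kx I idI JI; have [_ IMr] := idI.
    by apply: IMr; apply: Kx.
rewrite setC_bigcup; apply/seteqP; split=> P /= HP.
  move=> x; apply; first by case: (spec_prime P).
  by move=> i; have := HP i I; rewrite JE.
by move=> i _; rewrite JE => x Jx; apply: HP => I _ /(_ i); apply.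
Qed.

HB.instance Definition _ := isOpenTopological.Build (spec R)
  zariski_openT zariski_openI zariski_open_bigU.

Lemma spec_closedP (A : set (spec R)) :
  closed A <->
  exists2 I : set R, two_sided_ideal I & A = [set P : spec R | I `<=` P].
Proof.
rewrite -openC; split=> [[I idI]|[I idI ->]]; first by rewrite setCK; exists I.
by exists I => //; rewrite setCK.
Qed.

End Zariski.

Definition locally_closed_set (T : topologicalType) (A : set T) :=
  exists U C : set T, [/\ open U, closed C & A = U `&` C].

Definition homeomorphic (T U : topologicalType) :=
  exists (f : T -> U) (g : U -> T),
    [/\ cancel f g, cancel g f, continuous f & continuous g].

Definition spec_order_isomorphic (R S : nzRingType) :=
  exists2 f : spec R -> spec S, bijective f &
    forall P Q : spec R, P `<=` Q <-> f P `<=` f Q.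

Section PrimeQuotient.
Context (k : fieldType) (R : algType k) (P : spec R).

Let P0 : spec_ideal P 0. Proof. by case: (spec_prime P) => -[[]]. Qed.
Let PD x y : spec_ideal P x -> spec_ideal P y -> spec_ideal P (x + y).
Proof. by case: (spec_prime P) => -[[_ + _] _ _ _]; apply. Qed.
Let PMl r x : spec_ideal P x -> spec_ideal P (r * x).
Proof. by case: (spec_prime P) => -[[_ _ +] _ _ _]; apply. Qed.
Let PMr x r : spec_ideal P x -> spec_ideal P (x * r).
Proof. by case: (spec_prime P) => -[_ + _ _]; apply. Qed.
Let PN x : spec_ideal P x -> spec_ideal P (- x).
Proof. by rewrite -mulN1r; apply: PMl. Qed.
Let PZ (a : k) x : spec_ideal P x -> spec_ideal P (a *: x).
Proof. by rewrite -mulr_algl; apply: PMl. Qed.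

Definition spec_equiv (x y : R) : bool := `[< spec_ideal P (x - y) >].

Let spec_equiv_refl : reflexive spec_equiv.
Proof. by move=> x; apply/asboolP; rewrite subrr. Qed.
Let spec_equiv_sym : symmetric spec_equiv.
Proof.
by move=> x y; apply/asboolP/asboolP=> /PN; rewrite opprB.
Qed.
Let spec_equiv_trans : transitive spec_equiv.
Proof.
move=> y x z /asboolP xy /asboolP yz; apply/asboolP.
by rewrite -(subrKA y); apply: PD.
Qed.

Canonical spec_equiv_rel :=
  EquivRel spec_equiv spec_equiv_refl spec_equiv_sym spec_equiv_trans.

(* The quotient algebra R/P, with its canonical projection [spec_proj]. *)
Definition spec_quot : Type := {eq_quot spec_equiv_rel}.
HB.instance Definition _ := Choice.on spec_quot.
HB.instance Definition _ := Quotient.on spec_quot.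

Definition spec_proj (x : R) : spec_quot := \pi x.

Lemma spec_projP x y : spec_proj x = spec_proj y <-> spec_ideal P (x - y).
Proof.
split=> [xy|xy]; last exact/eqmodP/asboolP.
by apply/asboolP; move/eqP: xy; rewrite eqmodE.
Qed.

Definition sq_zero := spec_proj 0.
Definition sq_one := spec_proj 1.
Definition sq_opp (u : spec_quot) := spec_proj (- repr u).
Definition sq_add (u v : spec_quot) := spec_proj (repr u + repr v).
Definition sq_mul (u v : spec_quot) := spec_proj (repr u * repr v).
Definition sq_scale (a : k) (u : spec_quot) := spec_proj (a *: repr u).

Let reprP x : spec_ideal P (repr (spec_proj x) - x).
Proof. by apply/spec_projP; rewrite /spec_proj reprK. Qed.

Let oppE x : sq_opp (spec_proj x) = spec_proj (- x).
Proof. by apply/spec_projP; rewrite -opprD; apply: PN. Qed.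
Let addE x y : sq_add (spec_proj x) (spec_proj y) = spec_proj (x + y).
Proof. by apply/spec_projP; rewrite opprD addrACA; apply: PD. Qed.
Let mulE x y : sq_mul (spec_proj x) (spec_proj y) = spec_proj (x * y).
Proof.
apply/spec_projP; rewrite -(subrKA (x * repr (spec_proj y))).
by rewrite -mulrBl -mulrBr; apply: PD; [apply: PMr|apply: PMl].
Qed.
Let scaleE a x : sq_scale a (spec_proj x) = spec_proj (a *: x).
Proof. by apply/spec_projP; rewrite -scalerBr; apply: PZ. Qed.

Let projW (T : spec_quot -> Prop) : (forall x, T (spec_proj x)) -> forall u, T u.
Proof. by move=> Tp u; rewrite -[u]reprK; apply: Tp. Qed.

Let addA : associative sq_add.
Proof.
by elim/projW=> x; elim/projW=> y; elim/projW=> z; rewrite !addE addrA.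
Qed.
Let addC : commutative sq_add.
Proof. by elim/projW=> x; elim/projW=> y; rewrite !addE addrC. Qed.
Let add0 : left_id sq_zero sq_add.
Proof. by elim/projW=> x; rewrite addE add0r. Qed.
Let addN : left_inverse sq_zero sq_opp sq_add.
Proof. by elim/projW=> x; rewrite oppE addE addNr. Qed.

HB.instance Definition _ := GRing.isZmodule.Build spec_quot addA addC add0 addN.

Let mulA : associative sq_mul.
Proof.
by elim/projW=> x; elim/projW=> y; elim/projW=> z; rewrite !mulE mulrA.
Qed.
Let mul1 : left_id sq_one sq_mul.
Proof. by elim/projW=> x; rewrite mulE mul1r. Qed.
Let mulr1' : right_id sq_one sq_mul.
Proof. by elim/projW=> x; rewrite mulE mulr1. Qed.
Let mulDl : left_distributive sq_mul +%R.
Proof.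
by elim/projW=> x; elim/projW=> y; elim/projW=> z; rewrite /+%R/= addE !mulE addE mulrDl.
Qed.
Let mulDr : right_distributive sq_mul +%R.
Proof.
by elim/projW=> x; elim/projW=> y; elim/projW=> z; rewrite /+%R/= addE !mulE addE mulrDr.
Qed.
Let one_neq0 : sq_one != 0.
Proof.
apply/eqP=> /spec_projP; rewrite subr0.
by case: (spec_prime P).
Qed.

HB.instance Definition _ := GRing.Zmodule_isNzRing.Build spec_quot
  mulA mul1 mulr1' mulDl mulDr one_neq0.

Let scaleA a b u : sq_scale a (sq_scale b u) = sq_scale (a * b) u.
Proof. by elim/projW: u => x; rewrite !scaleE scalerA. Qed.
Let scale1 : left_id 1 sq_scale.
Proof. by elim/projW=> x; rewrite scaleE scale1r. Qed.
Let scaleDr : right_distributive sq_scale +%R.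
Proof.
by move=> a; elim/projW=> x; elim/projW=> y; rewrite /+%R/= addE !scaleE addE scalerDr.
Qed.
Let scaleDl u : {morph sq_scale^~ u : a b / a + b}.
Proof.
by elim/projW: u => x a b /=; rewrite !scaleE [RHS]addE scalerDl.
Qed.

HB.instance Definition _ := GRing.Zmodule_isLmodule.Build k spec_quot
  scaleA scale1 scaleDr scaleDl.

Let scaleAl (a : k) (u v : spec_quot) : a *: (u * v) = (a *: u) * v.
Proof.
elim/projW: u => x; elim/projW: v => y.
by rewrite /*:%R/= /*%R/= mulE !scaleE mulE scalerAl.
Qed.
HB.instance Definition _ := GRing.Lmodule_isLalgebra.Build k spec_quot scaleAl.

Let scaleAr (a : k) (u v : spec_quot) : a *: (u * v) = u * (a *: v).
Proof.
elim/projW: u => x; elim/projW: v => y.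
by rewrite /*:%R/= /*%R/= mulE !scaleE mulE scalerAr.
Qed.
HB.instance Definition _ := GRing.Lalgebra_isAlgebra.Build k spec_quot scaleAr.

Let proj_zmod : zmod_morphism spec_proj.
Proof. by move=> x y; rewrite /+%R/= /-%R/= oppE addE. Qed.
HB.instance Definition _ :=
  GRing.isZmodMorphism.Build R spec_quot spec_proj proj_zmod.
Let proj_monoid : monoid_morphism spec_proj.
Proof. by split=> // x y; rewrite /*%R/= mulE. Qed.
HB.instance Definition _ :=
  GRing.isMonoidMorphism.Build R spec_quot spec_proj proj_monoid.
Let proj_scalable : scalable spec_proj.
Proof. by move=> a x; rewrite /*:%R/= scaleE. Qed.
HB.instance Definition _ :=
  GRing.isScalable.Build k R spec_quot *:%R spec_proj proj_scalable.

End PrimeQuotient.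

Section Modules.
Context (R : nzRingType) (M : lmodType R).

Definition submodule (N : set M) :=
  [/\ N 0, forall x y, N x -> N y -> N (x + y) & forall r x, N x -> N (r *: x)].

Definition simple_module :=
  (exists x : M, x != 0) /\
  forall N : set M, submodule N -> N = [set 0] \/ N = setT.

Definition annihilator : set R := [set r | forall x : M, r *: x = 0].

End Modules.
Arguments simple_module {R} M.
Arguments annihilator {R} M.

(* [dim_lt_card V] is dim_k V < |k|, with [#<=] and [#!=] comparing
   cardinals. *)
Section Dimension.
Context (k : fieldType) (V : lmodType k).
Implicit Type B : set V.

Definition linearly_independent B :=
  forall (s : seq V) (c : V -> k), uniq s -> (forall x, x \in s -> B x) ->
    \sum_(x <- s) c x *: x = 0 -> forall x, x \in s -> c x = 0.

Definition spanning B :=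
  forall v : V, exists (s : seq V) (c : V -> k),
    (forall x, x \in s -> B x) /\ v = \sum_(x <- s) c x *: x.

Definition is_basis B := linearly_independent B /\ spanning B.

Definition dim_lt_card :=
  exists B : set V, [/\ is_basis B, B #<= [set: k] & B #!= [set: k]].

End Dimension.
Arguments dim_lt_card {k} V.

Definition is_inverse (A : nzRingType) (x y : A) := x * y = 1 /\ y * x = 1.

Definition regular_element (A : nzRingType) (s : A) :=
  GRing.lreg s /\ GRing.rreg s.

(* The classical ring of left quotients of [A], given by its defining property:
   regular elements of [A] become invertible and every element is a left
   fraction s^-1 a. When [A] is prime and left noetherian it exists by Goldie's
   theorem; it is always unique up to isomorphism over [A]. *)
Record goldie_quotient_ring (k : fieldType) (A : algType k) :=
    GoldieQuotientRing {
  goldie_ring :> algType k;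
  goldie_emb : {lrmorphism A -> goldie_ring};
  goldie_emb_inj : injective goldie_emb;
  goldie_emb_inv : forall s : A, regular_element s ->
    exists t, is_inverse (goldie_emb s) t;
  goldie_fraction : forall q : goldie_ring, exists (s a : A) t,
    [/\ regular_element s, is_inverse (goldie_emb s) t &
        q = t * goldie_emb a] }.

Definition center (A : nzRingType) : set A := [set z | forall x, z * x = x * z].
Arguments center : clear implicits.

Section DixmierMoeglin.
Context (k : fieldType) (R : algType k).

Definition locally_closed (P : spec R) := locally_closed_set [set P].

Definition primitive (P : spec R) :=
  exists M : lmodType R, simple_module M /\ spec_ideal P = annihilator M.

Definition rational (P : spec R) :=
  exists Q : goldie_quotient_ring (spec_quot P),
    forall z, center Q z ->
      exists2 p : {poly k}, p != 0 & root (map_poly (in_alg Q) p) z.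

Definition dixmier_moeglin :=
  forall P : spec R,
    (locally_closed P <-> primitive P) /\ (primitive P <-> rational P).

End DixmierMoeglin.
Arguments dixmier_moeglin {k} R.

(* Main.v *)
From HB Require Import structures.
From Stdlib Require List.
Require Import Defs.
From mathcomp Require Import all_boot all_order all_algebra.
From mathcomp Require Import generic_quotient.
From mathcomp Require Import all_classical topology_structure.

(** A prime [P] is locally closed iff finitely many primes strictly above [P] meet
    the down-set of every prime strictly above [P]: take the primes of a finite
    product contained in the intersection of the larger primes. The point is that,
    for uncountable [k], rationality has the same shape with "finitely many"
    replaced by "fewer than [|k|]" (a small cover). Both conditions only depend on
    the poset of primes. Since locally closed primes are primitive (Amitsur's trick)
    and primitive primes are rational in dimension less than [|k|], the equivalence
    for [R] says that small covers can be replaced by finite ones.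

    Let [A = R/P], let [Q] be its Goldie quotient ring and [z] a central element
    of [Q].
    - If all such [z] are algebraic, a Martindale-type argument gives, for each
      finite-dimensional subspace [V] of [A], one nonzero ideal contained in every
      ideal that meets [V] nontrivially; letting [V] run over the spans of finite
      subsets of a basis and taking the primes over these ideals yields a small
      cover.
    - Given a small cover, for each [a] in [k] some product of its primes lies in
      the ideal of multiples of [z - a]. By counting, one such product serves
      infinitely many [a], with quotients [(z - a)^-1 x] in a finite-dimensional
      subspace; a linear relation between them makes [z] algebraic.
    If [k] is countable, the algebras are finite-dimensional and a single [V]
    suffices. *)
Set Implicit Arguments.
Unset Strict Implicit.
Unset Printing Implicit Defensive.

Import GRing.Theory.
Local Open Scope ring_scope.
Local Open Scope quotient_scope.
Local Open Scope classical_set_scope.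
Local Open Scope card_scope.

(** * Cardinals *)

(** By totality, proved below, [~ embeds k X] says that |X| < |k|. *)
Definition embeds (X Y : Type) := exists f : X -> Y, injective f.

Lemma embeds_trans (X Y Z : Type) : embeds X Y -> embeds Y Z -> embeds X Z.
Proof. by move=> [f fI] [g gI]; exists (g \o f); apply: inj_comp. Qed.

(** Zorn's lemma on graphs of partial injections: a maximal one that is neither total nor onto could
    take one more pair. *)
Lemma embeds_total (X Y : Type) : embeds X Y \/ embeds Y X.
Proof.
pose P (G : set (X * Y)) :=
  (forall x y y', G (x, y) -> G (x, y') -> y = y') /\
  (forall x x' y, G (x, y) -> G (x', y) -> x = x').
have [F FP totF|G [[Gf Gi] Gmax]] := @Zorn_bigcup _ P.
  have two u v : (\bigcup_(G in F) G) u -> (\bigcup_(G in F) G) v ->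
      exists2 G, F G & G u /\ G v.
    move=> [G FG Gu] [H FH Hv].
    by have [s|s] := totF _ _ FG FH; [exists H|exists G] => //; split=> //; apply: s.
  split=> [x y y' u v|x x' y u v]; have [G FG [Gu Gv]] := two _ _ u v.
    exact: (FP _ FG).1 Gu Gv.
  exact: (FP _ FG).2 Gu Gv.
have [tX|/existsNP[x0 nx0]] := pselect (forall x, exists y, G (x, y)).
  have [f Gfx] := choice tX; left; exists f => x x' fE.
  by apply: (Gi _ _ (f x)) => //; rewrite fE.
have [tY|/existsNP[y0 ny0]] := pselect (forall y, exists x, G (x, y)).
  have [f Gfx] := choice tY; right; exists f => x x' fE.
  by apply: (Gf (f x)) => //; rewrite fE.
case: (Gmax (G `|` [set (x0, y0)])).
  split; first by move=> u; left.
  by move=> /(_ (x0, y0)) sub; apply: nx0; exists y0; apply: sub; right.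
split=> [x y y'|x x' y] [u|[/= -> ->]] [v|].
- exact: Gf u v.
- by move=> [? ?]; subst; case: nx0; exists y.
- by case: nx0; exists y'.
- by move=> h; injection h.
- exact: Gi u v.
- by move=> [? ?]; subst; case: ny0; exists x.
- by case: ny0; exists x'.
- by move=> h; injection h.
Qed.

(** Trades subtypes for functions on all of [W], the identity off [A], which can be mapped over
    words directly. *)
Lemma embeds_sets (W : Type) (A C : set W) : embeds {x | A x} {x | C x} ->
  exists f : W -> W, (forall a, A a -> C (f a)) /\
    (forall a b, A a -> A b -> f a = f b -> a = b).
Proof.
move=> [f fI].
exists (fun w => if pselect (A w) is left H then sval (f (exist _ w H)) else w).
split=> [a Aa|a b Aa Ab].
  by case: pselect => // H; apply: (svalP (f _)).
case: pselect => // Ha; case: pselect => // Hb.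
move=> /eq_sig_hprop E; suff /fI[] : f (exist _ a Ha) = f (exist _ b Hb) by [].
by apply: E => x; apply: Prop_irrelevance.
Qed.

(* Zorn's lemma on injections [seq A -> A]: if a maximal one lives on [A] and
   the complement of [A] does not embed into [A], then it contains a disjoint
   copy [A'] of [A], and [seq (A + A')] minus [seq A] can be sent into [A']. *)
Lemma embeds_seq (W : Type) : embeds nat W -> embeds (seq W) W.
Proof.
move=> [n nI].
pose inn (A : set W) (s : seq W) := forall x, List.In x s -> A x.
pose dm (G : set (seq W * W)) : set W := [set w | exists v, G ([:: w], v)].
(* [P G]: [G] is the graph of an injection from words over [A] to [A], where [A = dm G] is read off
   the one-letter words. The premise [dm G x] of the last clause admits the empty graph, the union
   of the empty chain. *)
pose P (G : set (seq W * W)) :=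
  [/\ forall s v v', G (s, v) -> G (s, v') -> v = v',
      forall s s' v, G (s, v) -> G (s', v) -> s = s',
      forall s v, G (s, v) -> dm G v /\ inn (dm G) s &
      forall s x, dm G x -> inn (dm G) s -> exists v, G (s, v)].
have [F FP totF|G [[Gf Gi Gd Gt] Gmax]] := @Zorn_bigcup _ P.
  have two u v : (\bigcup_(G in F) G) u -> (\bigcup_(G in F) G) v ->
      exists2 G, F G & G u /\ G v.
    move=> [G FG Gu] [H FH Hv].
    by have [s|s] := totF _ _ FG FH; [exists H|exists G] => //; split=> //; apply: s.
  have dmU G : F G -> dm G `<=` dm (\bigcup_(G in F) G).
    by move=> FG x [v Gv]; exists v; exists G.
  split.
  - by move=> s v v' u u'; have [G /FP[Gf _ _ _] []] := two _ _ u u'; apply: Gf.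
  - by move=> s v v' u u'; have [G /FP[_ Gi _ _] []] := two _ _ u u'; apply: Gi.
  - move=> s v [G FG Gu]; have [_ _ Gd _] := FP _ FG.
    have [dv ds] := Gd _ _ Gu; split; first exact: dmU dv.
    by move=> x /ds; apply: dmU.
  - move=> s x [v [G FG Gx]] sU.
    have [H FH [Hx Hs]] : exists2 H, F H & dm H x /\ inn (dm H) s.
      elim: s sU => [_|y s IH sU]; first by exists G => //; split=> //; exists v.
      have [z zs|H FH [Hx Hs]] := IH; first by apply: sU; right.
      have [w [K FK Kw]] := sU y (or_introl erefl).
      have [HK|KH] := totF _ _ FH FK.
        exists K => //; split; first by case: Hx => t Ht; exists t; apply: HK.
        move=> z [<-|/Hs[t Ht]]; first by exists w.
        by exists t; apply: HK.
      exists H => //; split=> // z [<-|/Hs//].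
      by exists w; apply: KH.
    have [_ _ _ Ht] := FP _ FH; have [w Hw] := Ht _ _ Hx Hs.
    by exists w; exists H.
(* If [A] is empty so is [G], and the image of [n], with [pickle], gives a larger graph. *)
have [a0 Aa0] : exists a, dm G a.
  apply: contrapT => noA.
  have G0 u : ~ G u by case: u => s v /Gd[dv _]; apply: noA; exists v.
  have dmE x : dm [set u | exists s : seq nat, u = (map n s, n (pickle s))] x <->
      exists m, x = n m.
    split=> [[v [[|m [|m' s]] //= [-> _]]]|[m ->]]; first by exists m.
    by exists (n (pickle [:: m])); exists [:: m].
  apply: (Gmax [set u | exists s : seq nat, u = (map n s, n (pickle s))]).
    split; first by move=> u /G0.
    move=> /(_ ([::], n (pickle ([::] : seq nat)))) sub.
    by case: (G0 _ (sub (ex_intro _ [::] erefl))).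
  split.
  - move=> s v v' [t [-> ->]] [t' [] /(inj_map nI) <- ->//].
  - move=> s s' v [t [-> ->]] [t' [] -> /nI /(pcan_inj pickleK) ->//].
  - move=> s v [t [-> ->]]; split; first by apply/dmE; eexists.
    elim: t => //= m t IH x [<-|/IH//]; first by apply/dmE; exists m.
  - move=> s x _ sn.
    have [t ->] : exists t, s = map n t.
      elim: s sn => [_|y s IH sn]; first by exists [::].
      have [t ->] := IH (fun z zs => sn z (or_intror zs)).
      have /dmE[m ->] := sn y (or_introl erefl).
      by exists (m :: t).
    by exists (n (pickle t)), t.
set A := dm G in Gd Gt Aa0.
have /choice[g gP] : forall s, exists v, inn A s -> G (s, v).
  move=> s; have [sA|] := pselect (inn A s); last by exists a0.
  by have [v Gv] := Gt _ _ Aa0 sA; exists v.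
have gA s : inn A s -> A (g s) by move=> /gP /Gd[].
have gI s t : inn A s -> inn A t -> g s = g t -> s = t.
  by move=> /gP Gs /gP Gt' E; apply: (Gi _ _ (g s)) => //; rewrite E.
have in1 a : A a -> inn A [:: a] by move=> Aa x [<-|].
have in2 a : A a -> inn A [:: a; a] by move=> Aa x [<-|[<-|]].
have inmap (B : set W) i s : (forall w, B w -> A (i w)) -> inn B s ->
    inn A (map i s).
  move=> iA; elim: s => [_ x []|w s IH sB x /= [<-|]].
    by apply: iA; apply: sB; left.
  by apply: IH => y ys; apply: sB; right.
have mapI (B : set W) (i : W -> W) s t : (forall w w', B w -> B w' -> i w = i w' -> w = w') ->
    inn B s -> inn B t -> map i s = map i t -> s = t.
  move=> iI; elim: s t => [|x s IH] [|y t] sB tB // /= -[xy st].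
  congr cons; first by apply: iI xy; [apply: sB; left|apply: tB; left].
  by apply: IH st => z zs; [apply: sB; right|apply: tB; right].
(* Letters of [A] are coded by words of length one and the others by words of length two, so codes
   of different kinds never collide. *)
pose enc (c : W -> W) w := g (if pselect (A w) then [:: w] else [:: c w; c w]).
have encP (B : set W) c : (forall w, B w -> ~ A w -> A (c w)) ->
    (forall w w', B w -> B w' -> ~ A w -> ~ A w' -> c w = c w' -> w = w') ->
    (forall w, B w -> A (enc c w)) /\
    (forall w w', B w -> B w' -> enc c w = enc c w' -> w = w').
  move=> cA cI; split=> [w Bw|w w' Bw Bw']; rewrite /enc.
    by case: pselect => /= H; apply: gA; [apply: in1|apply/in2/cA].
  case: pselect => /= H; case: pselect => /= H' /gI E.
  - by case: (E (in1 _ H) (in1 _ H')).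
  - by have := E (in1 _ H) (in2 _ (cA _ Bw' H')).
  - by have := E (in2 _ (cA _ Bw H)) (in1 _ H').
  - by case: (E (in2 _ (cA _ Bw H)) (in2 _ (cA _ Bw' H'))) => /cI h _; apply: h.
(* Either the complement of [A] embeds into [A], and coding letter by letter ends the proof, or [A]
   has a copy outside itself. *)
have [/embeds_sets[c [cA cI]]|/embeds_sets[c [cA cI]]] :=
    embeds_total {x | (~` A) x} {x | A x}.
  have [eA eI] := encP setT c (fun w _ => cA w) (fun w w' _ _ => cI w w').
  have inT s : inn setT s by [].
  exists (fun s => g (map (enc c) s)) => s t E.
  apply: (mapI setT (enc c)) => //; apply: gI => //; exact: (inmap setT).
pose A' : set W := [set w | exists2 a, A a & w = c a].
pose B := A `|` A'.
have /choice[d dP] : forall w, exists a, A' w -> A a /\ c a = w.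
  move=> w; have [[a Aa ->]|] := pselect (A' w); last by exists a0.
  by exists a.
have BA' w : B w -> ~ A w -> A' w by move=> [].
have [eA eI] : (forall w, B w -> A (enc d w)) /\
    (forall w w', B w -> B w' -> enc d w = enc d w' -> w = w').
  apply: encP => [w Bw nAw|w w' Bw Bw' nA nA' dE].
    exact: (dP _ (BA' _ Bw nAw)).1.
  rewrite -(dP _ (BA' _ Bw nA)).2 -(dP _ (BA' _ Bw' nA')).2.
  by rewrite dE.
pose h s := g (map (enc d) s).
have hA s : inn B s -> A (h s) by move=> sB; apply: gA; apply: inmap sB.
have hI s t : inn B s -> inn B t -> h s = h t -> s = t.
  move=> sB tB /gI E; apply: (mapI B (enc d)) => //.
  by apply: E; apply: (inmap B).
(* New words take their values in [A'], away from the values of [G], which lie in [A]; this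
   contradicts maximality. *)
pose G' : set (seq W * W) :=
  G `|` [set u | [/\ inn B u.1, ~ inn A u.1 & u.2 = c (h u.1)]].
have dmE w : dm G' w <-> B w.
  split=> [[v [Gv|[/= + _ _]]]|[[v Gv]|A'w]].
  - by left; exists v.
  - by apply; left.
  - by exists v; left.
  - have nAw : ~ A w by case: A'w => a Aa ->; apply: cA.
    exists (c (h [:: w])); right; split=> //=.
      by move=> x [<-|//]; right.
    by move=> /(_ w (or_introl erefl)).
have GA s v : G (s, v) -> inn A s by move=> /Gd[].
have GAv s v : G (s, v) -> A v by move=> /Gd[].
case: (Gmax G').
  split; first by move=> u; left.
  move=> sub; have : G ([:: c a0], c (h [:: c a0])).
    apply: sub; right; split=> /=.
    - by move=> x [<-|//]; right; exists a0.
    - by move=> /(_ (c a0) (or_introl erefl)); apply: cA.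
    - by [].
  by move=> /GA /(_ (c a0) (or_introl erefl)); apply: cA.
split.
- move=> s v v' [u|[/= ? nA ->]] [u'|[/= ? nA' ->]] //.
  + exact: Gf u u'.
  + by case: nA'; apply: GA u.
  + by case: nA; apply: GA u'.
- move=> s s' v [u|[/= sB nA ->]] [u'|[/= sB' nA' vE]] //.
  + exact: Gi u u'.
  + by move: (GAv _ _ u); rewrite vE => Av; case: (cA _ (hA _ sB') Av).
  + by move: (GAv _ _ u'); rewrite ?vE => Av; case: (cA _ (hA _ sB) Av).
  + by apply: hI => //; apply: cI vE; apply: hA.
- move=> s v [u|[/= sB nA ->]].
    have [dv ds] := Gd _ _ u; split; first by apply/dmE; left.
    by move=> x /ds ?; apply/dmE; left.
  split; first by apply/dmE; right; exists (h s) => //; apply: hA.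
  by move=> x /sB ?; apply/dmE.
- move=> s x _ sB; have [sA|nsA] := pselect (inn A s).
    by exists (g s); left; apply: gP.
  by exists (c (h s)); right; split=> //= y /sB /dmE.
Qed.

Lemma embeds_pair_seq (W : Type) : embeds nat W -> embeds (seq W * seq W * nat) W.
Proof.
move=> nW; have [g gI] := embeds_seq nW; have [n nI] := nW.
exists (fun u => g [:: g u.1.1; g u.1.2; n u.2]) => -[[s t] i] [[s' t'] i'].
by move=> /gI[/gI -> /gI -> /nI ->].
Qed.

Lemma embeds_map (X Y : Type) : embeds X Y -> embeds (seq X) (seq Y).
Proof. by move=> [f fI]; exists (map f); apply: inj_map. Qed.

(** Otherwise all fibres are finite, and [x] is determined by [f x] and its position in the fibre.
    Then [K] embeds into [seq X * seq Y * nat], which is no larger than the largest of [X], [Y] and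
    [nat]. *)
Lemma infinite_fibre (K : choiceType) (X Y : Type) (f : K -> seq X * seq Y) :
  ~ embeds K nat -> ~ embeds K X -> ~ embeds K Y ->
  exists u, forall n, exists s : seq K,
    [/\ uniq s, size s = n & forall x, x \in s -> f x = u].
Proof.
move=> nKn nKX nKY; apply: contrapT => /forallNP bad.
have [W [nKW [nW XW YW]]] : exists W : Type, ~ embeds K W /\
    [/\ embeds nat W, embeds X W & embeds Y W].
  have idE Z : embeds Z Z by exists id.
  have [XY|YX] := embeds_total X Y.
    have [nY|Yn] := embeds_total nat Y; first by exists Y; split.
    by exists nat; split=> //; split=> //; apply: embeds_trans Yn.
  have [nX|Xn] := embeds_total nat X; first by exists X; split.
  by exists nat; split=> //; split=> //; apply: embeds_trans Xn.
apply: nKW; apply: (@embeds_trans _ (seq X * seq Y * nat)); last first.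
  have [i iI] := embeds_map XW; have [j jI] := embeds_map YW.
  apply: embeds_trans (embeds_pair_seq nW).
  by exists (fun u => (i u.1.1, j u.1.2, u.2)) => -[[? ?] ?] [[? ?] ?] [/iI -> /jI -> ->].
have /choice[l lP] : forall u, exists l : seq K, forall x, f x = u -> x \in l.
  move=> u; have /existsNP[n /forallNP no] := bad u.
  (* Induction on n - m: a list of [m] distinct elements of the fibre either exhausts it or grows,
     and it cannot reach length [n]. *)
  have : forall m, (exists s : seq K, [/\ uniq s, size s = m & forall x, x \in s -> f x = u]) ->
      exists l : seq K, forall x, f x = u -> x \in l.
    move=> m; elim: {m}(n - m)%N {-2}m (leqnn (n - m)) => [|d IH] m dm [s [us ss su]].
      case: (no (take n s)); split; first exact: take_uniq.
        by rewrite size_takel// ss -subn_eq0 -leqn0.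
      by move=> x /mem_take /su.
    have [sub|/existsNP[x /not_implyP[fx /negP xs]]] := pselect (forall x, f x = u -> x \in s).
      by exists s.
    have [mn|nm] := ltnP m n; last first.
      case: (no (take n s)); split; first exact: take_uniq.
        by rewrite size_takel// ss.
      by move=> y /mem_take /su.
    apply: (IH m.+1).
      by rewrite subnS -ltnS prednK ?subn_gt0// ; apply: leq_trans dm.
    exists (x :: s); split; rewrite /= ?xs ?ss//.
    by move=> y; rewrite inE => /orP[/eqP ->|/su].
  by apply; exists [::].
exists (fun x => (f x, index x (l (f x)))) => x y [fE iE].
have xl := lP _ _ (erefl (f x)); have yl := lP _ _ (erefl (f y)).
by rewrite -(nth_index x xl) iE fE nth_index.
Qed.

(** * Prime left noetherian rings *)

Section Ideals.
Context (A : nzRingType).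
Implicit Types (I J E N : set A) (x y z : A).

Lemma left_idealN I x : left_ideal I -> I x -> I (- x).
Proof. by move=> [_ _ IM] Ix; rewrite -mulN1r; apply: IM. Qed.

Lemma left_idealB I x y : left_ideal I -> I x -> I y -> I (x - y).
Proof. by move=> lI Ix Iy; have [_ ID _] := lI; apply: ID => //; apply: left_idealN. Qed.

Lemma left_ideal_sum I (T : eqType) (s : seq T) (F : T -> A) :
  left_ideal I -> (forall i, i \in s -> I (F i)) -> I (\sum_(i <- s) F i).
Proof.
move=> [I0 ID _]; elim: s => [|i s IH] Is; first by rewrite big_nil.
rewrite big_cons; apply: ID; first by apply: Is; rewrite mem_head.
by apply: IH => j js; apply: Is; rewrite inE js orbT.
Qed.

Lemma left_idealI I J : left_ideal I -> left_ideal J -> left_ideal (I `&` J).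
Proof.
move=> [I0 ID IM] [J0 JD JM]; split=> //.
  by move=> x y [? ?] [? ?]; split; [apply: ID|apply: JD].
by move=> r x [? ?]; split; [apply: IM|apply: JM].
Qed.

Lemma two_sided_idealI I J :
  two_sided_ideal I -> two_sided_ideal J -> two_sided_ideal (I `&` J).
Proof.
move=> [lI IM] [lJ JM]; split; first exact: left_idealI.
by move=> x r [? ?]; split; [apply: IM|apply: JM].
Qed.

Lemma left_ideal_add I J : left_ideal I -> left_ideal J ->
  left_ideal [set x + y | x in I & y in J].
Proof.
move=> [I0 ID IM] [J0 JD JM]; split.
- by exists 0 => //; exists 0; rewrite ?addr0.
- move=> _ _ [x Ix [y Jy <-]] [x' Ix' [y' Jy' <-]].
  exists (x + x'); first exact: ID.
  by exists (y + y'); [exact: JD|rewrite addrACA].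
- move=> r _ [x Ix [y Jy <-]]; exists (r * x); first exact: IM.
  by exists (r * y); [exact: JM|rewrite mulrDr].
Qed.

Lemma two_sided_ideal_add I J : two_sided_ideal I -> two_sided_ideal J ->
  two_sided_ideal [set x + y | x in I & y in J].
Proof.
move=> [lI IMr] [lJ JMr]; split; first exact: left_ideal_add.
move=> _ r [x Ix [y Jy <-]]; exists (x * r); first exact: IMr.
by exists (y * r); [exact: JMr|rewrite mulrDl].
Qed.

Lemma left_ideal_mul x : left_ideal [set r * x | r in setT].
Proof.
split; first by exists 0 => //; rewrite mul0r.
  by move=> _ _ [r _ <-] [s _ <-]; exists (r + s) => //; rewrite mulrDl.
by move=> r _ [s _ <-]; exists (r * s) => //; rewrite mulrA.
Qed.

Lemma left_ideal_ann x : left_ideal [set r | r * x = 0].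
Proof.
split; rewrite /= ?mul0r//; first by move=> r s; rewrite mulrDl => -> ->; rewrite addr0.
by move=> r s; rewrite -mulrA => ->; rewrite mulr0.
Qed.

Definition essential E := forall y, y != 0 -> exists a, a * y != 0 /\ E (a * y).

Definition prime_ring := forall x y, (forall r, x * r * y = 0) -> x = 0 \/ y = 0.

End Ideals.

Section Noetherian.
Context (A : nzRingType).
Hypothesis noeth : left_noetherian A.
Implicit Types (I J E N : set A) (x y z : A).

Lemma noetherian_max (F : set (set A)) : F !=set0 ->
  (forall I, F I -> left_ideal I) ->
  exists2 I, F I & forall J, F J -> I `<=` J -> J = I.
Proof.
move=> [I0 FI0] Fl; apply: contrapT => nomax.
have /choice[g gP] : forall I, exists J, F I -> [/\ F J, I `<=` J & J <> I].
  move=> I; have [FI|] := pselect (F I); last by exists I.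
  apply: contrapT => noJ; apply: nomax; exists I => // J FJ IJ.
  by apply: contrapT => nJI; apply: noJ; exists J.
pose I n := iter n g I0.
have FI n : F (I n) by elim: n => //= n /gP[].
have [N NP] := noeth (fun n => Fl _ (FI n)) (fun n => let: And3 _ s _ := gP _ (FI n) in s).
by have [_ _ []] := gP _ (FI N); apply: (NP N.+1).
Qed.

Hypothesis prim : prime_ring A.

(** Utumi's argument: take [a] nonzero in [N] with maximal left annihilator. If (a r)^m a is the
    last nonzero element of its kind, its annihilator contains that of [a], so equals it; since a r
    kills it, a r a = 0. Thus a A a = 0, against primeness. *)
Lemma nil_left_ideal N : left_ideal N -> (forall x, N x -> exists n, x ^+ n = 0) ->
  forall x, N x -> x = 0.
Proof.
move=> lN nil x Nx; apply/eqP; apply: contrapT => /negP x0.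
have [|_ [y _ <-]|_ [a [Na a0] <-] amax] := @noetherian_max
  [set [set r : A | r * y = 0] | y in [set y | N y /\ y != 0]].
- by exists [set r | r * x = 0]; exists x.
- exact: left_ideal_ann.
suff aAa r : a * r * a = 0 by case: (prim aAa) => E; rewrite E eqxx in a0.
have [_ ND NM] := lN.
have [n rn] := nil _ (NM r a Na).
have an : (a * r) ^+ n * a = 0.
  suff -> : (a * r) ^+ n * a = a * (r * a) ^+ n by rewrite rn mulr0.
  by elim: n {rn} => [|n IH]; rewrite ?mul1r ?mulr1// exprS -mulrA IH exprS !mulrA.
have [m mP mmin] := ex_minnP (ex_intro (fun n => (a * r) ^+ n * a == 0) n (introT eqP an)).
case: m mP mmin => [|m] mP mmin; first by rewrite mul1r (negPf a0) in mP.
have ma0 : (a * r) ^+ m * a != 0 by apply/negP => /mmin; rewrite ltnn.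
have E := amax _ (ex_intro2 _ _ _ (conj (NM _ _ Na) ma0) erefl).
have : [set s | s * ((a * r) ^+ m * a) = 0] (a * r).
  by rewrite /= mulrA -exprS; apply/eqP.
rewrite E// => s /= sa.
have -> : (a * r) ^+ m * a = a * (r * a) ^+ m.
  by elim: m {mP mmin ma0 E} => [|m IH]; rewrite ?mul1r ?mulr1// exprS -mulrA IH exprS !mulrA.
by rewrite mulrA sa mul0r.
Qed.

(** The left ideal [A y] is nil: if y^n is nonzero with maximal left annihilator, essentiality gives
    [a] with a y^n nonzero but a y^(n+1) = 0. *)
Lemma left_singular y : essential [set r | r * y = 0] -> y = 0.
Proof.
move=> ey; apply: (@nil_left_ideal [set r * y | r in setT]).
- exact: left_ideal_mul.
- move=> _ [r _ <-].
  (* Left multiples of a singular element are singular, so nilpotency of [y] itself suffices. *)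
  have {ey} : essential [set s | s * (r * y) = 0].
    move=> z z0; have [zr|zr] := eqVneq (z * r) 0.
      by exists 1; rewrite mul1r /= mulrA zr mul0r.
    have [a [azr /= azry]] := ey _ zr; exists a; split; last by rewrite /= mulrA -(mulrA a).
    by apply/eqP => E; move: azr; rewrite mulrA E mul0r eqxx.
  move: (r * y) => {r}y ey.
  have [|_ [n _ <-]|_ [n _ <-] nmax] := @noetherian_max
      [set [set r : A | r * y ^+ n = 0] | n in setT].
  + by exists [set r | r * y ^+ 0 = 0]; exists 0%N.
  + exact: left_ideal_ann.
  exists n; apply/eqP; apply: contrapT => /negP yn0.
  have [a [ay /= ayy]] := ey _ yn0.
  have E := nmax _ (ex_intro2 _ _ n.+1 I erefl).
  suff : [set r : A | r * y ^+ n = 0] a by move=> /= ay0; rewrite ay0 eqxx in ay.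
  rewrite -E /=; first by rewrite exprSr mulrA.
  by move=> r /= ry; rewrite exprSr mulrA ry mul0r.
- by exists 1; rewrite ?mul1r.
Qed.

(* If [A z] met [A c] trivially, [A z + A z c + A z c^2 + ...] would be an infinite
   direct sum. *)
Lemma essential_mul c : (forall x, x * c = 0 -> x = 0) ->
  essential [set r * c | r in setT].
Proof.
move=> cI z z0; apply: contrapT => nz.
have {}nz a x : a * z = x * c -> a * z = 0.
  by move=> E; apply: contrapT => /eqP az; apply: nz; exists a; split=> //; exists x.
(* [I n] is the sum of the A z c^i for i < n. *)
pose I := fix I n : set A :=
  if n is n'.+1 then [set u | exists a y, I n' y /\ u = a * z + y * c] else [set 0].
have lI n : left_ideal (I n).
  elim: n => [|n [I0 ID IM]] /=.
    split=> //; first by move=> x y /= -> ->; rewrite addr0.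
    by move=> r x /= ->; rewrite mulr0.
  split.
  - by exists 0, 0; split=> //; rewrite !mul0r addr0.
  - move=> _ _ [a [y [Iy ->]]] [a' [y' [Iy' ->]]]; exists (a + a'), (y + y').
    by split; [apply: ID|rewrite !mulrDl addrACA].
  - move=> r _ [a [y [Iy ->]]]; exists (r * a), (r * y).
    by split; [apply: IM|rewrite mulrDr !mulrA].
have II n : I n `<=` I n.+1.
  elim: n => [|n IH] x; first by move=> ->; have [] := lI 1%N.
  by move=> [a [y [Iy ->]]]; exists a, y; split=> //; apply: IH.
have [N NP] := noeth lI II.
have Iz n : I n.+1 (z * c ^+ n).
  elim: n => [|n IH]; first by exists 1, 0; rewrite mul0r mul1r addr0 mulr1.
  by exists 0, (z * c ^+ n); split=> //; rewrite mul0r add0r exprSr mulrA.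
(* Cancelling [c] on the right leads from z c^N in [I N] down to [z] in [I 0], which is zero. *)
have : I N (z * c ^+ N) by rewrite -(NP N.+1).
elim: N {NP} => [|n IH]; first by move=> /=; rewrite mulr1; apply/eqP.
move=> [a [y [Iy E]]].
have az : a * z = 0.
  by apply: (nz _ (z * c ^+ n - y)); rewrite mulrBl -mulrA -exprSr E addrK.
apply: IH; suff -> : z * c ^+ n = y by [].
by apply/eqP; rewrite -subr_eq0; apply/eqP/cI; rewrite mulrBl -mulrA -exprSr E az add0r subrr.
Qed.

(** If c x = c y, the essential left ideal [A c] annihilates x - y, which is therefore singular,
    hence zero. *)
Lemma regular_of_left c : (forall x, x * c = 0 -> x = 0) -> regular_element c.
Proof.
move=> cI; split; last first.
  by move=> x y E; apply/eqP; rewrite -subr_eq0; apply/eqP/cI; rewrite mulrBl E subrr.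
move=> x y E; apply/eqP; rewrite -subr_eq0; apply/eqP/left_singular => z z0.
have [a [az [r _ rc]]] := essential_mul cI z0; exists a; split=> //=.
by rewrite -rc -mulrA mulrBr E subrr mulr0.
Qed.

(* [c] is a sum [a1 + ... + an] with [ai c = 0] for [c = a1 + ... + a(i-1)]; [S] is
   the direct sum of the [A ai], which noetherianity allows to take maximal. *)
Lemma essential_regular E : left_ideal E -> essential E ->
  exists2 c, E c & regular_element c.
Proof.
move=> lE eE; have [E0 ED EM] := lE.
pose good S c := [/\ left_ideal S, S `<=` E, S c & forall s, S s -> s * c = 0 -> s = 0].
have [|S [c [lS _ _ _]]|S [c [lS SE Sc cI]] Smax] := @noetherian_max
    [set S | exists c, good S c].
- exists [set 0], 0; split=> //; last by move=> x ->.
  split=> //; first by move=> x y -> ->; rewrite addr0.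
  by move=> r x ->; rewrite mulr0.
- by [].
(* Adding [A a] to [S] and [a] to [c] preserves [good], so maximality puts [a] in [S], where a c = 0
   forces a = 0. *)
have {}Smax a : E a -> a * c = 0 -> (forall x, x * a * a = 0 -> x * a = 0) -> a = 0.
  move=> Ea ac aa.
  have SE' : [set x + y | x in S & y in [set r * a | r in setT]] = S.
    have [S0 SD SM] := lS; apply: Smax; last first.
      by move=> x Sx; exists x => //; exists 0; rewrite ?addr0//; exists 0; rewrite ?mul0r.
    exists (c + a); split.
    - by apply: left_ideal_add => //; apply: left_ideal_mul.
    - by move=> _ [x /SE Ex [_ [r _ <-] <-]]; apply: ED => //; apply: EM.
    - by exists c => //; exists a => //; exists 1; rewrite ?mul1r.
    - move=> _ [s Ss [_ [r _ <-] <-]].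
      rewrite mulrDr !mulrDl -(mulrA r) ac mulr0 addr0 => h.
      have sc : s * c = 0.
        apply: cI; first exact: SM.
        have : (s * c + (s * a + r * a * a)) * c = 0 by rewrite h mul0r.
        by rewrite !mulrDl -!(mulrA _ a c) ac !mulr0 !addr0.
      have s0 : s = 0 by apply: cI.
      by move: h; rewrite s0 !mul0r !add0r => /aa.
  suff Sa : S a by apply: cI.
  rewrite -SE'; have [S0 _ _] := lS.
  by exists 0 => //; exists a; rewrite ?add0r//; exists 1; rewrite ?mul1r.
exists c; first exact: SE.
apply: regular_of_left => x xc.
(* A nonzero left annihilator of [c] would meet [E]. But the elements of [N] are nilpotent: a power
   with maximal left annihilator can be taken for [a] in [Smax]. *)
pose N := E `&` [set r | r * c = 0].
have lN : left_ideal N by apply: left_idealI => //; apply: left_ideal_ann.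
have N0 : forall x, N x -> x = 0.
  apply: nil_left_ideal => // u [Eu uc].
  have [|_ [n _ <-]|_ [n _ <-] nmax] := @noetherian_max
      [set [set r : A | r * u ^+ n.+1 = 0] | n in setT].
  + by exists [set r | r * u ^+ 1 = 0]; exists 0%N.
  + exact: left_ideal_ann.
  exists n.+1; apply: Smax.
  - by rewrite exprSr; apply: EM.
  - by rewrite exprSr -mulrA uc mulr0.
  - move=> y; rewrite -mulrA -exprD addnS => yu.
    suff : [set r : A | r * u ^+ n.+1 = 0] y by [].
    rewrite -(nmax _ (ex_intro2 _ _ (n.+1 + n)%N I erefl))//.
    by move=> r /= ru; rewrite -addnS exprD mulrA ru mul0r.
apply/eqP; apply: contrapT => /negP x0; have [a [ax Eax]] := eE _ x0.
by move: ax; rewrite (N0 (a * x)) ?eqxx//; split=> //=; rewrite -mulrA xc mulr0.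
Qed.

Lemma ideal_essential I : two_sided_ideal I -> (exists2 x, I x & x != 0) -> essential I.
Proof.
move=> [[_ _ IM] IMr] [x Ix x0] y y0; apply: contrapT => no.
have [|E|E] := prim (x := x) (y := y); last 2 first.
- by rewrite E eqxx in x0.
- by rewrite E eqxx in y0.
move=> r; apply/eqP; apply: contrapT => /negP xry; apply: no; exists (x * r).
by split=> //; apply: (IMr); apply: (IMr).
Qed.

End Noetherian.

(** * The Goldie quotient ring *)

(** The quotient ring is built from module maps on essential left ideals, as a maximal left quotient
    ring, rather than from Ore fractions. Values of [phom_fun] outside [phom_dom] are irrelevant. *)
Record partial_hom (A : nzRingType) := PartialHom {
  phom_dom : set A;
  phom_fun : A -> A;
  phom_ideal : left_ideal phom_dom;
  phom_essential : essential phom_dom;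
  phom_add : forall x y, phom_dom x -> phom_dom y ->
    phom_fun (x + y) = phom_fun x + phom_fun y;
  phom_mul : forall r x, phom_dom x -> phom_fun (r * x) = r * phom_fun x }.

HB.instance Definition _ (A : nzRingType) := gen_eqMixin (partial_hom A).
HB.instance Definition _ (A : nzRingType) := gen_choiceMixin (partial_hom A).

Section GoldieQuotient.
Context (k : fieldType) (A : algType k).
Hypothesis sing : forall y : A, essential [set r | r * y = 0] -> y = 0.
Implicit Types f g h : partial_hom A.

Lemma phom0 f : phom_fun f 0 = 0.
Proof.
have [f0 _ _] := phom_ideal f.
by have := phom_mul 0 f0; rewrite !mul0r.
Qed.

Lemma essential_preimage f (E : set A) : left_ideal E -> essential E ->
  essential (phom_dom f `&` phom_fun f @^-1` E).
Proof.
move=> [E0 _ _] eE y y0; have [a [ay fay]] := phom_essential f y0.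
have [_ _ fM] := phom_ideal f.
have [fz|fz] := eqVneq (phom_fun f (a * y)) 0.
  by exists a; split=> //; split=> //=; rewrite fz.
have [b [bf Eb]] := eE _ fz; exists (b * a); rewrite -mulrA; split.
  by apply/eqP => E'; move: bf; rewrite -phom_mul// E' phom0 eqxx.
by split; [apply: fM|rewrite /= phom_mul].
Qed.

Lemma essentialI (E F : set A) : left_ideal E -> left_ideal F ->
  essential E -> essential F -> essential (E `&` F).
Proof.
move=> [_ _ EM] _ eE eF y y0; have [a [ay Eay]] := eE _ y0.
have [b [bay Fb]] := eF _ ay; exists (b * a); rewrite -mulrA; split=> //.
by split=> //; apply: EM.
Qed.

Lemma left_ideal_preimage f (E : set A) : left_ideal E ->
  left_ideal (phom_dom f `&` phom_fun f @^-1` E).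
Proof.
move=> [E0 ED EM]; have [f0 fD fM] := phom_ideal f; split.
- by split=> //=; rewrite phom0.
- move=> x y [fx Ex] [fy Ey]; split; first exact: fD.
  by rewrite /= phom_add//; apply: ED.
- move=> r x [fx Ex]; split; first exact: fM.
  by rewrite /= phom_mul//; apply: EM.
Qed.

(* Agreement on the common domain is transitive only because the left singular
   ideal [sing] vanishes. *)
Definition phom_equiv f g : bool :=
  `[< forall x, phom_dom f x -> phom_dom g x -> phom_fun f x = phom_fun g x >].

Let equiv_refl : reflexive phom_equiv.
Proof. by move=> f; apply/asboolP. Qed.
Let equiv_sym : symmetric phom_equiv.
Proof. by move=> f g; apply/asboolP/asboolP => h x fx gx; rewrite h. Qed.
Let equiv_trans : transitive phom_equiv.
Proof.
move=> g f h /asboolP fg /asboolP gh; apply/asboolP => x fx hx.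
apply/eqP; rewrite -subr_eq0; apply/eqP/sing => y y0.
have [yx|yx] := eqVneq (y * x) 0.
  exists 1; rewrite mul1r; split=> //=; rewrite mulrBr -!phom_mul// yx.
  by rewrite !phom0 subrr.
have [a [ayx gayx]] := phom_essential g yx; exists a.
split; first by apply/eqP => E; move: ayx; rewrite mulrA E mul0r eqxx.
have [[_ _ fM] [_ _ hM]] := (phom_ideal f, phom_ideal h).
rewrite /= mulrBr -!phom_mul// -mulrA fg//; last by do 2!apply: (fM).
by rewrite gh// ?subrr//; do 2!apply: (hM).
Qed.

Canonical phom_equiv_rel :=
  EquivRel phom_equiv equiv_refl equiv_sym equiv_trans.

Definition lquot : Type := {eq_quot phom_equiv_rel}.
HB.instance Definition _ := Choice.on lquot.
HB.instance Definition _ := Quotient.on lquot.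

Definition lquot_class f : lquot := \pi f.

Lemma lquot_classP f g : lquot_class f = lquot_class g <->
  forall x, phom_dom f x -> phom_dom g x -> phom_fun f x = phom_fun g x.
Proof.
split=> [xy|xy]; last exact/eqmodP/asboolP.
by apply/asboolP; move/eqP: xy; rewrite eqmodE.
Qed.

Let classW (T : lquot -> Prop) : (forall f, T (lquot_class f)) -> forall u, T u.
Proof. by move=> Tp u; rewrite -[u]reprK; apply: Tp. Qed.

Let reprP f x : phom_dom (repr (lquot_class f)) x -> phom_dom f x ->
  phom_fun (repr (lquot_class f)) x = phom_fun f x.
Proof. by move: x; apply/lquot_classP; rewrite /lquot_class reprK. Qed.

Let leftT : left_ideal [set: A]. Proof. by []. Qed.
Let essT : essential [set: A].
Proof. by move=> y y0; exists 1; rewrite mul1r. Qed.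

Definition phom_right (a : A) : partial_hom A.
Proof.
by exists setT (fun x => x * a) => //; [move=> x y; rewrite mulrDl|move=> r x; rewrite mulrA].
Defined.

Definition phom_opp f : partial_hom A.
Proof.
exists (phom_dom f) (fun x => - phom_fun f x).
- exact: phom_ideal.
- exact: phom_essential.
- by move=> x y fx fy; rewrite phom_add// opprD.
- by move=> r x fx; rewrite phom_mul// mulrN.
Defined.

Definition phom_sum f g : partial_hom A.
Proof.
exists (phom_dom f `&` phom_dom g) (fun x => phom_fun f x + phom_fun g x).
- by apply: left_idealI; apply: phom_ideal.
- by apply: essentialI; (exact: phom_ideal || exact: phom_essential).
- by move=> x y [? ?] [? ?]; rewrite !phom_add// addrACA.
- by move=> r x [? ?]; rewrite !phom_mul// mulrDr.
Defined.

(* Partial homomorphisms of left modules act on the right, hence the order. *)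
Definition phom_comp f g : partial_hom A.
Proof.
exists (phom_dom f `&` phom_fun f @^-1` phom_dom g) (fun x => phom_fun g (phom_fun f x)).
- exact/left_ideal_preimage/phom_ideal.
- by apply: essential_preimage; [exact: phom_ideal|exact: phom_essential].
- by move=> x y [? ?] [? ?]; rewrite !phom_add.
- by move=> r x [? ?]; rewrite !phom_mul.
Defined.

Definition phom_scale (c : k) f : partial_hom A.
Proof.
exists (phom_dom f) (fun x => c *: phom_fun f x).
- exact: phom_ideal.
- exact: phom_essential.
- by move=> x y fx fy; rewrite phom_add// scalerDr.
- by move=> r x fx; rewrite phom_mul// scalerAr.
Defined.

Definition lq_emb (a : A) : lquot := lquot_class (phom_right a).
Definition lq_opp (u : lquot) := lquot_class (phom_opp (repr u)).
Definition lq_add (u v : lquot) := lquot_class (phom_sum (repr u) (repr v)).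
Definition lq_mul (u v : lquot) := lquot_class (phom_comp (repr u) (repr v)).
Definition lq_scale (c : k) (u : lquot) := lquot_class (phom_scale c (repr u)).

Let oppE f : lq_opp (lquot_class f) = lquot_class (phom_opp f).
Proof. by apply/lquot_classP => x /= fx fx'; rewrite reprP. Qed.
Let addE f g : lq_add (lquot_class f) (lquot_class g) = lquot_class (phom_sum f g).
Proof. by apply/lquot_classP => x /= [fx gx] [fx' gx']; rewrite !reprP. Qed.
Let mulE f g : lq_mul (lquot_class f) (lquot_class g) = lquot_class (phom_comp f g).
Proof.
apply/lquot_classP => x [fx gx] [fx' gx'].
by move: gx; rewrite /preimage /= (reprP fx fx') => gx; apply: reprP.
Qed.
Let scaleE c f : lq_scale c (lquot_class f) = lquot_class (phom_scale c f).
Proof. by apply/lquot_classP => x /= fx fx'; rewrite reprP. Qed.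

Let addA : associative lq_add.
Proof.
elim/classW=> f; elim/classW=> g; elim/classW=> h; rewrite !addE.
by apply/lquot_classP => x /= _ _; rewrite addrA.
Qed.
Let addC : commutative lq_add.
Proof.
elim/classW=> f; elim/classW=> g; rewrite !addE.
by apply/lquot_classP => x /= _ _; rewrite addrC.
Qed.
Let add0 : left_id (lq_emb 0) lq_add.
Proof.
elim/classW=> f; rewrite addE; apply/lquot_classP => x /= _ _.
by rewrite mulr0 add0r.
Qed.
Let addN : left_inverse (lq_emb 0) lq_opp lq_add.
Proof.
elim/classW=> f; rewrite oppE addE; apply/lquot_classP => x /= _ _.
by rewrite addNr mulr0.
Qed.

HB.instance Definition _ := GRing.isZmodule.Build lquot addA addC add0 addN.

Let mulA : associative lq_mul.
Proof.
elim/classW=> f; elim/classW=> g; elim/classW=> h; rewrite !mulE.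
exact/lquot_classP.
Qed.
Let mul1 : left_id (lq_emb 1) lq_mul.
Proof.
elim/classW=> f; rewrite mulE; apply/lquot_classP => x /= _ _.
by rewrite mulr1.
Qed.
Let mulr1' : right_id (lq_emb 1) lq_mul.
Proof.
elim/classW=> f; rewrite mulE; apply/lquot_classP => x /= _ _.
by rewrite mulr1.
Qed.
Let mulDl : left_distributive lq_mul +%R.
Proof.
elim/classW=> f; elim/classW=> g; elim/classW=> h; rewrite /+%R/= addE !mulE addE.
apply/lquot_classP => x /= [[fx gx] hx] [[_ hfx] [_ hgx]].
by rewrite phom_add.
Qed.
Let mulDr : right_distributive lq_mul +%R.
Proof.
elim/classW=> f; elim/classW=> g; elim/classW=> h; rewrite /+%R/= addE !mulE addE.
exact/lquot_classP.
Qed.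
Let one_neq0 : lq_emb 1 != 0.
Proof.
apply/eqP=> /lquot_classP/(_ 1 I I)/=/eqP.
by rewrite mulr1 mulr0 oner_eq0.
Qed.

HB.instance Definition _ := GRing.Zmodule_isNzRing.Build lquot
  mulA mul1 mulr1' mulDl mulDr one_neq0.

Let scaleA a b u : lq_scale a (lq_scale b u) = lq_scale (a * b) u.
Proof.
elim/classW: u => f; rewrite !scaleE; apply/lquot_classP => x /= _ _.
by rewrite scalerA.
Qed.
Let scale1 : left_id 1 lq_scale.
Proof.
elim/classW=> f; rewrite !scaleE; apply/lquot_classP => x /= _ _.
by rewrite scale1r.
Qed.
Let scaleDr : right_distributive lq_scale +%R.
Proof.
move=> a; elim/classW=> f; elim/classW=> g; rewrite /+%R/= addE !scaleE addE.
by apply/lquot_classP => x /= _ _; rewrite scalerDr.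
Qed.
Let scaleDl u : {morph lq_scale^~ u : a b / a + b}.
Proof.
elim/classW: u => f a b /=; rewrite !scaleE [RHS]addE.
by apply/lquot_classP => x /= _ _; rewrite scalerDl.
Qed.

HB.instance Definition _ := GRing.Zmodule_isLmodule.Build k lquot
  scaleA scale1 scaleDr scaleDl.

Let phomZ f c x : phom_dom f x -> phom_fun f (c *: x) = c *: phom_fun f x.
Proof. by move=> fx; rewrite -mulr_algl phom_mul// mulr_algl. Qed.

Let scaleAl (a : k) (u v : lquot) : a *: (u * v) = (a *: u) * v.
Proof.
elim/classW: u => f; elim/classW: v => g.
rewrite /*:%R/= /*%R/= mulE !scaleE mulE; apply/lquot_classP => x /= [_ gx] _.
by rewrite phomZ.
Qed.
HB.instance Definition _ := GRing.Lmodule_isLalgebra.Build k lquot scaleAl.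

Let scaleAr (a : k) (u v : lquot) : a *: (u * v) = u * (a *: v).
Proof.
elim/classW: u => f; elim/classW: v => g.
by rewrite /*:%R/= /*%R/= mulE !scaleE mulE; apply/lquot_classP.
Qed.
HB.instance Definition _ := GRing.Lalgebra_isAlgebra.Build k lquot scaleAr.

Let emb_zmod : zmod_morphism lq_emb.
Proof.
move=> x y; rewrite /+%R/= /-%R/= oppE addE.
by apply/lquot_classP => z /= _ _; rewrite mulrBr.
Qed.
HB.instance Definition _ := GRing.isZmodMorphism.Build A lquot lq_emb emb_zmod.
Let emb_monoid : monoid_morphism lq_emb.
Proof.
split=> // x y; rewrite /*%R/= mulE.
by apply/lquot_classP => z /= _ _; rewrite mulrA.
Qed.
HB.instance Definition _ := GRing.isMonoidMorphism.Build A lquot lq_emb emb_monoid.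
Let emb_scalable : scalable lq_emb.
Proof.
move=> a x; rewrite /*:%R/= scaleE.
by apply/lquot_classP => z /= _ _; rewrite scalerAr.
Qed.
HB.instance Definition _ := GRing.isScalable.Build k A lquot *:%R lq_emb emb_scalable.

Lemma lq_emb_inj : injective lq_emb.
Proof. by move=> a b /lquot_classP/(_ 1 I I) /=; rewrite !mul1r. Qed.

Lemma lq_emb_mul f c : phom_dom f c ->
  lq_emb c * lquot_class f = lq_emb (phom_fun f c).
Proof.
move=> fc; rewrite {1}/*%R/= mulE; apply/lquot_classP => x /= _ _.
by rewrite phom_mul.
Qed.

Lemma lq_emb_inv s : regular_element s -> essential [set r * s | r in setT] ->
  exists t, is_inverse (lq_emb s) t.
Proof.
move=> [_ sI] es.
have /choice[g gP] : forall x, exists r, [set r * s | r in setT] x -> r * s = x.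
  by move=> x; have [[r _ <-]|] := pselect ([set r * s | r in setT] x); [exists r|exists 0].
have gE r : g (r * s) = r by apply: sI; apply: gP; exists r.
(* The inverse of [s] is the map sending r s to [r] on the essential left ideal [A s]. *)
have @f : partial_hom A.
  exists [set r * s | r in setT] g => //; first exact: left_ideal_mul.
    by move=> _ _ [x _ <-] [y _ <-]; rewrite -mulrDl !gE.
  by move=> r _ [x _ <-]; rewrite mulrA !gE.
exists (lquot_class f); split.
  by rewrite lq_emb_mul /=; [rewrite -[s]mul1r gE|exists 1; rewrite ?mul1r].
rewrite {1}/*%R/= mulE; apply/lquot_classP => _ /= [[r _ <-] _] _.
by rewrite gE mulr1.
Qed.

End GoldieQuotient.

(** The class of [f] is the fraction s^-1 f(s) for a regular [s] in the domain of [f], which exists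
    because that domain is essential. *)
Lemma goldie (k : fieldType) (A : algType k) :
  left_noetherian A -> prime_ring A -> inhabited (goldie_quotient_ring A).
Proof.
move=> noeth prim; pose sing := left_singular noeth prim.
have inv (s : A) : regular_element s -> exists t, is_inverse (lq_emb sing s) t.
  move=> rs; apply: lq_emb_inv => //; apply: essential_mul => // x xs.
  by apply: rs.2; rewrite mul0r.
constructor; apply: (@GoldieQuotientRing k A (lquot sing) (lq_emb sing)).
- exact: lq_emb_inj.
- exact: inv.
- move=> q; rewrite -[q]reprK; set f := repr q.
  have [s fs rs] := essential_regular noeth prim (phom_ideal f) (@phom_essential _ f).
  have [t [st ts]] := inv _ rs; exists s, (phom_fun f s), t; split=> //.
  transitivity (t * (lq_emb sing s * lquot_class sing f)).
    by rewrite mulrA ts mul1r.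
  by rewrite lq_emb_mul.
Qed.

(** * Linear algebra and the extended centroid *)

Section Span.
Context (k : fieldType) (V : lmodType k).
Implicit Types (F G : seq V) (v : V).

(** Coefficients form a row vector, so that linear dependence can be read off the kernel of a
    matrix. *)
Definition in_span F v := exists c : 'rV[k]_(size F), v = \sum_i c 0 i *: F`_i.

Lemma in_span0 F : in_span F 0.
Proof. by exists 0; rewrite big1// => i _; rewrite mxE scale0r. Qed.

Lemma in_spanD F u v : in_span F u -> in_span F v -> in_span F (u + v).
Proof.
move=> [c ->] [d ->]; exists (c + d); rewrite -big_split.
by apply: eq_bigr => i _; rewrite mxE scalerDl.
Qed.

Lemma in_spanZ F a v : in_span F v -> in_span F (a *: v).
Proof.
move=> [c ->]; exists (a *: c); rewrite scaler_sumr.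
by apply: eq_bigr => i _; rewrite mxE scalerA.
Qed.

Lemma in_span_sum F (I : eqType) (r : seq I) (f : I -> V) :
  (forall i, i \in r -> in_span F (f i)) -> in_span F (\sum_(i <- r) f i).
Proof.
move=> fF; rewrite big_seq; apply: big_ind => //; first exact: in_span0.
exact: in_spanD.
Qed.

Lemma in_span_mem F v : v \in F -> in_span F v.
Proof.
move=> vF; have iF : (index v F < size F)%N by rewrite index_mem.
exists (delta_mx 0 (Ordinal iF)); rewrite (bigD1 (Ordinal iF))//= !mxE !eqxx scale1r.
rewrite nth_index// big1 ?addr0// => i ni.
by rewrite mxE eqxx (negPf ni) scale0r.
Qed.

Lemma in_span_trans F G v : (forall x, x \in F -> in_span G x) ->
  in_span F v -> in_span G v.
Proof.
move=> FG [c ->]; apply: in_span_sum => i _.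
by apply/in_spanZ/FG; rewrite mem_nth.
Qed.

(** The coefficient matrix has more rows than columns, so its kernel is nonzero. The relation is
    indexed by [T], since [f] may repeat values. *)
Lemma in_span_dependent (T : eqType) (s : seq T) (f : T -> V) F :
  uniq s -> (size F < size s)%N -> (forall t, t \in s -> in_span F (f t)) ->
  exists c : T -> k, (exists2 t, t \in s & c t != 0) /\
    \sum_(t <- s) c t *: f t = 0.
Proof.
move=> us Fs fF.
have /choice[m mP] : forall t, exists m : 'rV[k]_(size F),
    t \in s -> f t = \sum_i m 0 i *: F`_i.
  move=> t; have [ts|_] := boolP (t \in s); last by exists 0.
  by have [m ->] := fF t ts; exists m.
pose M : 'M[k]_(size s, size F) := \matrix_(i, j) m (tnth (in_tuple s) i) 0 j.
have : ~~ row_free M by rewrite /row_free neq_ltn (leq_ltn_trans (rank_leq_col M)).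
rewrite -kermx_eq0 => /rowV0Pn[u /sub_kermxP uM /rV0Pn[i0 ui0]].
pose c t := if insub (index t s) is Some i then u 0 i else 0.
have cE i : c (tnth (in_tuple s) i) = u 0 i.
  have t0 := tnth (in_tuple s) i.
  rewrite /c (tnth_nth t0) /= index_uniq//.
  by case: insubP => [j _ /val_inj ->//|]; rewrite ltn_ord.
exists c; split; first by exists (tnth (in_tuple s) i0); rewrite ?mem_tnth ?cE.
rewrite big_tnth; transitivity (\sum_i \sum_j (u 0 i * M i j) *: F`_j).
  apply: eq_bigr => i _; rewrite cE mP ?mem_tnth// scaler_sumr.
  by apply: eq_bigr => j _; rewrite scalerA mxE.
rewrite exchange_big big1//= => j _; rewrite -scaler_suml.
have /matrixP/(_ 0 j) := uM; rewrite !mxE => ->.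
by rewrite scale0r.
Qed.

End Span.

Lemma in_span_mul (k : fieldType) (B : algType k) (F G H : seq B) u v :
  in_span F u -> in_span G v ->
  (forall x y, x \in F -> y \in G -> in_span H (x * y)) -> in_span H (u * v).
Proof.
move=> [c ->] [d ->] FGH; rewrite mulr_suml; apply: in_span_sum => i _.
rewrite mulr_sumr; apply: in_span_sum => j _.
rewrite -scalerAl -scalerAr; do 2!apply: in_spanZ.
by apply: FGH; rewrite mem_nth.
Qed.

Lemma in_span_map (k : fieldType) (V W : lmodType k) (f : {linear V -> W})
  (F : seq V) v : in_span F v -> in_span (map f F) (f v).
Proof.
move=> [c ->]; rewrite linear_sum; apply: in_span_sum => i _.
by rewrite linearZ; apply/in_spanZ/in_span_mem/map_f; rewrite mem_nth.
Qed.

(** * Polynomials from relations between resolvents *)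

Section Resolvent.
Context (k : fieldType).
Implicit Types (s : seq k) (c : k -> k).

(* The numerator of [\sum_(a <- s) c a / ('X - a)]. *)
Definition resolvent_poly s c : {poly k} :=
  \sum_(a <- s) c a *: \prod_(b <- rem a s) ('X - b%:P).

(** At [a] only the term of index [a] survives, and it is [c a] times a product of nonzero
    differences. *)
Lemma resolvent_poly_neq0 s c : uniq s -> (exists2 a, a \in s & c a != 0) ->
  resolvent_poly s c != 0.
Proof.
move=> us [a sa ca]; apply/eqP => /(congr1 (fun p => p.[a])); apply/eqP.
rewrite horner0 horner_sum (big_rem a)//= [X in _ + X]big1_seq ?addr0 => [|b].
  rewrite hornerZ horner_prod mulf_neq0// prodf_seq_neq0; apply/allP => b.
  by rewrite hornerXsubC subr_eq0 mem_rem_uniq// inE eq_sym => /andP[].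
rewrite /= mem_rem_uniq// inE => /andP[ba bs].
rewrite hornerZ horner_prod (big_rem a) /= ?hornerXsubC ?subrr ?mul0r ?mulr0//.
by rewrite mem_rem_uniq// inE eq_sym ba.
Qed.

Lemma horner_alg_eval (B : algType k) (z : B) (p : {poly k}) :
  horner_alg z p = (map_poly (in_alg B) p).[z].
Proof. by []. Qed.

Lemma horner_algXsubC (B : algType k) (z : B) a :
  horner_alg z ('X - a%:P) = z - a%:A.
Proof. by rewrite rmorphB /= horner_algX horner_algC. Qed.

Lemma horner_alg_sum (B : algType k) (z : B) (p : {poly k}) n : (size p <= n)%N ->
  horner_alg z p = \sum_(i < n) p`_i *: z ^+ i.
Proof.
move=> pn; rewrite horner_alg_eval (@horner_coef_wide _ n); last first.
  by rewrite (leq_trans (size_poly _ _)).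
by apply: eq_bigr => i _; rewrite coef_map /= mulr_algl.
Qed.

Lemma horner_alg_comm (B : algType k) (z x : B) p : GRing.comm x z ->
  GRing.comm x (horner_alg z p).
Proof.
move=> xz; rewrite (horner_alg_sum z (leqnn _)); apply: commr_sum => i _.
by rewrite /GRing.comm -scalerAl -scalerAr (commrX i xz).
Qed.

Lemma divp_polyX (p : {poly k}) : exists a, p = p %/ 'X * 'X + a%:P.
Proof.
exists (p %% 'X)`_0; rewrite {1}(divp_eq p 'X); congr (_ + _); apply: size1_polyC.
by rewrite -ltnS (leq_trans (ltn_modpN0 _ _)) ?size_polyX// polyX_eq0.
Qed.

(** Here [d a] plays the role of y / (z - a); multiplying the relation by the product of all z - b
    clears the denominators. *)
Lemma resolvent_annihilates (B : algType k) (z y : B) (d : k -> B) s c :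
  (forall a, a \in s -> (z - a%:A) * d a = y) ->
  \sum_(a <- s) c a *: d a = 0 -> horner_alg z (resolvent_poly s c) * y = 0.
Proof.
move=> dy sd; rewrite linear_sum mulr_suml.
transitivity (horner_alg z (\prod_(b <- s) ('X - b%:P)) * \sum_(a <- s) c a *: d a).
  rewrite mulr_sumr; apply: eq_big_seq => a sa.
  rewrite -mul_polyC rmorphM /= horner_algC -mulrA mulr_algl -scalerAr.
  congr (_ *: _).
  rewrite -(dy a sa) mulrA -horner_algXsubC -rmorphM.
  by rewrite [in RHS](big_rem a sa) /= mulrC.
by rewrite sd mulr0.
Qed.

End Resolvent.

Section MultiplicationIdeal.
Context (A : nzRingType).
Implicit Types (x y : A) (s t : seq (A * A)).

(** The action on [x] of a tensor, given by [s], in the enveloping ring of [A]. *)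
Definition msum s x := \sum_(p <- s) p.1 * x * p.2.

Lemma msumD s x y : msum s (x + y) = msum s x + msum s y.
Proof. by rewrite /msum -big_split; apply: eq_bigr => p _; rewrite mulrDr mulrDl. Qed.

Lemma msum_cat s t x : msum (s ++ t) x = msum s x + msum t x.
Proof. by rewrite /msum big_cat. Qed.

Lemma msum1 a b x : msum [:: (a, b)] x = a * x * b.
Proof. by rewrite /msum big_seq1. Qed.

Lemma msum_map a b s x :
  msum [seq (a * p.1, p.2 * b) | p <- s] x = a * msum s x * b.
Proof.
rewrite /msum big_map mulr_sumr mulr_suml.
by apply: eq_bigr => p _; rewrite /= !mulrA.
Qed.

Definition principal_ideal x : set A := [set y | exists s, y = msum s x].

Lemma principal_ideal_two_sided x : two_sided_ideal (principal_ideal x).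
Proof.
split; first split.
- by exists [::]; rewrite /msum big_nil.
- by move=> _ _ [s ->] [t ->]; exists (s ++ t); rewrite msum_cat.
- by move=> r _ [s ->]; exists [seq (r * p.1, p.2 * 1) | p <- s]; rewrite msum_map mulr1.
- by move=> _ r [s ->]; exists [seq (1 * p.1, p.2 * r) | p <- s]; rewrite msum_map mul1r.
Qed.

Lemma principal_ideal_mem x : principal_ideal x x.
Proof. by exists [:: (1, 1)]; rewrite msum1 mul1r mulr1. Qed.

Lemma principal_ideal_sub I x : two_sided_ideal I -> I x -> principal_ideal x `<=` I.
Proof.
move=> [lI IMr] Ix _ [s ->]; apply: left_ideal_sum => // p _.
by apply: (IMr); have [_ _ IM] := lI; apply: IM.
Qed.

End MultiplicationIdeal.

(** * The centre of the Goldie quotient ring *)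

Section QuotientCenter.
Context (k : fieldType) (A : algType k).
Hypotheses (noeth : left_noetherian A) (prim : prime_ring A).
Context (Q : goldie_quotient_ring A).
Local Notation "'emb'" := (goldie_emb Q) (at level 0).
Implicit Types (z w : Q) (x y a : A).

Lemma embM x y : emb (x * y) = emb x * emb y. Proof. exact: rmorphM. Qed.
Lemma embD x y : emb (x + y) = emb x + emb y. Proof. exact: rmorphD. Qed.
Lemma emb0 : emb 0 = 0. Proof. exact: rmorph0. Qed.
Lemma embZ (c : k) x : emb (c *: x) = c *: emb x. Proof. exact: linearZ. Qed.
Lemma emb_sum (I : Type) (r : seq I) (f : I -> A) :
  emb (\sum_(i <- r) f i) = \sum_(i <- r) emb (f i).
Proof. exact: rmorph_sum. Qed.

Lemma regularM x y : regular_element x -> regular_element y -> regular_element (x * y).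
Proof. by move=> [xl xr] [yl yr]; split; [apply: GRing.lregM|apply: GRing.rregM]. Qed.

Lemma regular1 : regular_element (1 : A).
Proof. by split=> x y; rewrite ?mul1r ?mulr1. Qed.

Lemma emb_reg_eq0 x z : regular_element x -> z * emb x = 0 -> z = 0.
Proof.
by move=> /goldie_emb_inv-/(_ Q)[t [xt _]] zx; rewrite -[z]mulr1 -xt mulrA zx mul0r.
Qed.

Lemma center_comm z w : center Q z -> GRing.comm w z.
Proof. by move=> cz; rewrite /GRing.comm cz. Qed.

Lemma centerM z w : center Q z -> center Q w -> center Q (z * w).
Proof. by move=> cz cw x; rewrite -mulrA cw mulrA cz mulrA. Qed.

Lemma centerX z n : center Q z -> center Q (z ^+ n).
Proof. by move=> cz x; apply/commr_sym/commrX/center_comm. Qed.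

Lemma center_horner z (p : {poly k}) : center Q z -> center Q (horner_alg z p).
Proof. by move=> cz x; apply/commr_sym/horner_alg_comm/center_comm. Qed.

Lemma center_span (F : seq Q) z : (forall w, w \in F -> center Q w) -> in_span F z -> center Q z.
Proof.
move=> cF [c ->] x; rewrite mulr_suml mulr_sumr; apply: eq_bigr => i _.
by rewrite -scalerAl -scalerAr cF// mem_nth.
Qed.

Lemma center_emb z : (forall a, z * emb a = emb a * z) -> center Q z.
Proof.
move=> cz q; have [s [a [t [rs [st ts] ->]]]] := goldie_fraction q.
have zt : z * t = t * z.
  by rewrite -[z * t]mul1r -ts -mulrA (mulrA (emb s)) -cz -(mulrA z) st mulr1.
by rewrite mulrA zt -!mulrA cz.
Qed.

Definition denominators z : set A := [set d | exists a, emb a = z * emb d].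

Lemma denominators_ideal z : center Q z -> two_sided_ideal (denominators z).
Proof.
move=> cz; split; first split.
- by exists 0; rewrite !emb0 mulr0.
- by move=> x y [a aE] [b bE]; exists (a + b); rewrite !embD mulrDr aE bE.
- by move=> r x [a aE]; exists (r * a); rewrite !embM aE !mulrA cz.
- by move=> x r [a aE]; exists (a * r); rewrite !embM aE !mulrA.
Qed.

Lemma denominators_regular z : center Q z ->
  exists2 s, regular_element s & denominators z s.
Proof.
move=> cz; have [s [a [t [rs [st ts] zE]]]] := goldie_fraction z.
by exists s => //; exists a; rewrite cz zE mulrA st mul1r.
Qed.

(** The contraction to [A] of z A. For z - a in place of [z], it consists of the elements that z - a
    divides with quotient in [A]. *)
Definition multiples z : set A := [set i | exists d, emb i = z * emb d].

Lemma multiples_ideal z : center Q z -> two_sided_ideal (multiples z).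
Proof.
move=> cz; split; first split.
- by exists 0; rewrite emb0 mulr0.
- by move=> x y [d dE] [e eE]; exists (d + e); rewrite !embD mulrDr dE eE.
- by move=> r x [d dE]; exists (r * d); rewrite !embM dE !mulrA cz.
- by move=> x r [d dE]; exists (d * r); rewrite !embM dE !mulrA.
Qed.

Lemma multiples_neq0 z : center Q z -> z != 0 -> exists2 x, multiples z x & x != 0.
Proof.
move=> cz z0; have [s rs [x xE]] := denominators_regular cz; exists x; first by exists s.
by apply: contraNneq z0 => x0; apply/eqP/(emb_reg_eq0 rs); rewrite -xE x0 emb0.
Qed.

Lemma common_denominator (F : seq Q) : (forall z, z \in F -> center Q z) ->
  exists2 s, regular_element s & forall z, z \in F -> denominators z s.
Proof.
elim: F => [|z F IH] cF; first by exists 1 => //; apply: regular1.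
have [w wF|s rs sF] := IH; first by apply: cF; rewrite inE wF orbT.
have cz : center Q z by apply: cF; rewrite mem_head.
have [t rt tz] := denominators_regular cz.
exists (s * t); first exact: regularM.
move=> w; rewrite inE => /orP[/eqP ->|wF].
  by have [[_ _ M] _] := denominators_ideal cz; apply: M.
have [|_ M] := @denominators_ideal w; first by apply: cF; rewrite inE wF orbT.
by apply: M; apply: sF.
Qed.

Lemma denominators_span (F : seq Q) z d : (forall w, w \in F -> denominators w d) ->
  in_span F z -> denominators z d.
Proof.
move=> dF [c ->].
have /choice[f fP] : forall i : 'I_(size F), exists a, emb a = F`_i * emb d.
  by move=> i; apply: dF; rewrite mem_nth.
exists (\sum_i c 0 i *: f i); rewrite emb_sum mulr_suml; apply: eq_bigr => i _.
by rewrite embZ fP scalerAl.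
Qed.

(** If [s] is a regular denominator and a = z s, then a A x = 0, so a = 0 by primeness. *)
Lemma center_mul_eq0 z x : center Q z -> z * emb x = 0 -> x != 0 -> z = 0.
Proof.
move=> cz zx x0; have [s rs [a aE]] := denominators_regular cz.
have a0 : a = 0.
  have [||x0'] // := prim (x := a) (y := x); last by rewrite x0' eqxx in x0.
  move=> r; apply: (@goldie_emb_inj _ _ Q); rewrite emb0 !embM aE.
  by rewrite (cz (emb s)) -(mulrA _ z) (cz (emb r)) -!mulrA zx !mulr0.
by apply: (emb_reg_eq0 rs); rewrite -aE a0 emb0.
Qed.

Lemma center_domain z w : center Q z -> center Q w -> z * w = 0 -> z != 0 -> w = 0.
Proof.
move=> cz cw zw z0; have [s rs [a aE]] := denominators_regular cw.
apply: (emb_reg_eq0 rs); rewrite -aE.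
have [->|a0] := eqVneq a 0; first by rewrite emb0.
suff E : z = 0 by rewrite E eqxx in z0.
by apply: (center_mul_eq0 cz) a0; rewrite aE mulrA zw mul0r.
Qed.

(* Martindale's lemma: a bimodule map out of a nonzero ideal is multiplication by
   an element of the extended centroid, here the centre of the Goldie quotient. *)
Lemma martindale x y : x != 0 -> (forall s, msum s x = 0 -> msum s y = 0) ->
  exists2 z, center Q z & emb y = z * emb x.
Proof.
move=> x0 xy; have Ix := principal_ideal_two_sided x.
(* The ideal of [x] contains a regular element b = [msum s0 x]; then [z] has to be b^-1 times the
   image [msum s0 y] of b. *)
have [_ [s0 ->] rb] := essential_regular noeth prim Ix.1
  (ideal_essential prim Ix (ex_intro2 _ _ x (principal_ideal_mem x) x0)).
have [t [bt tb]] := goldie_emb_inv Q rb.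
pose z := t * emb (msum s0 y).
have zE s : emb (msum s y) = z * emb (msum s x).
  (* With b = [msum s0 x], the product b ([msum s x]) is obtained from [x] in two ways. Transported
     to [y], the equality reads ([msum s0 y]) ([msum s x]) = b ([msum s y]). *)
  have : msum ([seq (1 * p.1, p.2 * msum s x) | p <- s0] ++
               [seq (- msum s0 x * p.1, p.2 * 1) | p <- s]) y = 0.
    apply: xy; rewrite msum_cat !msum_map mul1r mulr1 mulNr.
    by rewrite subrr.
  rewrite msum_cat !msum_map mul1r mulr1 mulNr => /eqP; rewrite subr_eq0 => /eqP E.
  by rewrite /z -mulrA -embM E embM mulrA tb mul1r.
have yE : emb y = z * emb x by have := zE [:: (1, 1)]; rewrite !msum1 !mul1r !mulr1.
exists z => //; apply: center_emb => a.
apply/eqP; rewrite -subr_eq0; apply/eqP/(emb_reg_eq0 rb).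
move: z zE yE => z zE yE.
rewrite mulrBl -!mulrA -zE -embM -[a * _]mulr1 -msum_map -zE msum_map mulr1 embM.
by rewrite subrr.
Qed.

Hypothesis alg : forall z, center Q z -> exists2 p : {poly k}, p != 0 & horner_alg z p = 0.

Lemma algebraic_powers z (p : {poly k}) n : p != 0 -> horner_alg z p = 0 ->
  in_span [seq z ^+ j | j <- iota 0 (size p)] (z ^+ n).
Proof.
move=> p0 zp; have -> : z ^+ n = horner_alg z ('X^n %% p).
  transitivity (horner_alg z 'X^n); first by rewrite rmorphXn /= horner_algX.
  by rewrite {1}(divp_eq 'X^n p) rmorphD rmorphM /= zp mulr0 add0r.
rewrite (@horner_alg_sum _ _ z _ (size p)); last by rewrite ltnW// ltn_modp.
apply: in_span_sum => i _; apply/in_spanZ/in_span_mem/map_f.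
by rewrite mem_iota /= add0n.
Qed.

(** Adjoins the elements one at a time: multiplying a spanning list by finitely many powers of the
    algebraic central [z] keeps it closed under products. *)
Lemma finite_subalgebra (F : seq Q) : (forall z, z \in F -> center Q z) ->
  exists G : seq Q, [/\ forall z, z \in G -> center Q z,
    in_span G 1, forall z, z \in F -> in_span G z &
    forall z w, in_span G z -> in_span G w -> in_span G (z * w)].
Proof.
elim: F => [|z F IH] cF.
  exists [:: 1]; split=> //.
  - by move=> z; rewrite inE => /eqP -> x; rewrite mul1r mulr1.
  - by apply: in_span_mem; rewrite mem_head.
  - move=> z w Gz Gw; apply: (in_span_mul Gz Gw) => x y.
    rewrite !inE => /eqP -> /eqP ->; rewrite mulr1.
    by apply: in_span_mem; rewrite mem_head.
have [w wF|G [cG G1 FG GM]] := IH; first by apply: cF; rewrite inE wF orbT.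
have cz : center Q z by apply: cF; rewrite mem_head.
have [p p0 zp] := alg cz.
pose X := [seq z ^+ j | j <- iota 0 (size p)].
pose H := [seq z1 * w1 | z1 <- X, w1 <- G].
have XGH (x y : Q) : in_span X x -> in_span G y -> in_span H (x * y).
  move=> Xx Gy; apply: (in_span_mul Xx Gy) => u v uX vG.
  by apply/in_span_mem/allpairs_f.
have GH (y : Q) : in_span G y -> in_span H y.
  by move=> Gy; rewrite -[y]mul1r -(expr0 z); apply: XGH => //; apply: algebraic_powers.
exists H; split.
- move=> w /allpairsP[[x y] /= [/mapP[j _ ->] yG ->]].
  by apply: centerM; [apply: centerX|apply: cG].
- exact: GH.
- move=> w; rewrite inE => /orP[/eqP ->|wF]; last exact/GH/FG.
  by rewrite -[z]mulr1; apply: XGH => //; rewrite -[z]expr1; apply: algebraic_powers.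
- move=> u v Hu Hv; apply: (in_span_mul Hu Hv) => {Hu Hv}u' v'.
  move=> /allpairsP[[x y] /= [/mapP[j _ ->] yG ->]].
  move=> /allpairsP[[x' y'] /= [/mapP[j' _ ->] yG' ->]].
  rewrite mulrA -(mulrA _ y) (cG _ yG) mulrA -exprD -mulrA.
  by apply: XGH; [apply: algebraic_powers|apply: GM; apply: in_span_mem].
Qed.

(** A polynomial of least size killing [w] has nonzero constant term, because the centre is a
    domain; solving for that term gives the inverse. *)
Lemma finite_subalgebra_inv (G : seq Q) w : (forall z, z \in G -> center Q z) ->
  in_span G 1 -> (forall z w, in_span G z -> in_span G w -> in_span G (z * w)) ->
  in_span G w -> w != 0 -> exists2 w', in_span G w' & w' * w = 1.
Proof.
move=> cG G1 GM Gw w0; have cw := center_span cG Gw.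
have GX n : in_span G (w ^+ n) by elim: n => // n IH; rewrite exprS; apply: GM.
have Gh p : in_span G (horner_alg w p).
  rewrite (horner_alg_sum w (leqnn _)); apply: in_span_sum => i _.
  exact: in_spanZ.
have [p0 p0N p0w] := alg cw.
have ex : exists n, `[< exists p : {poly k}, [/\ p != 0, horner_alg w p = 0 & size p = n] >].
  by exists (size p0); apply/asboolP; exists p0.
have [n /asboolP[p [pN pw pn]] nmin] := ex_minnP ex.
have [c pE] := divp_polyX p.
move: pw; rewrite {1}pE rmorphD rmorphM /= horner_algX horner_algC.
have [c0|c0] := eqVneq c 0.
  rewrite c0 scale0r addr0 => qw.
  have q0 : horner_alg w (p %/ 'X) = 0.
    by apply: (center_domain cw) w0; [exact: center_horner|rewrite cw].
  have qN : p %/ 'X != 0 by apply: contraNneq pN => E; rewrite pE E c0 mul0r addr0.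
  have : (n <= size (p %/ 'X)%R)%N by apply/nmin/asboolP; exists (p %/ 'X).
  have -> : n = (size (p %/ 'X)%R).+1 by rewrite -pn [in LHS]pE c0 addr0 size_mulX.
  by rewrite ltnn.
move=> /eqP; rewrite addr_eq0 => /eqP qw.
exists (- c^-1 *: horner_alg w (p %/ 'X)); first exact: in_spanZ.
by rewrite -scalerAl qw scaleNr scalerN opprK scalerA mulVf// scale1r.
Qed.

(** As [W] is only an [lmodType], the kernel on [U] is obtained as a subspace of largest dimension
    killed by [g]. *)
Lemma linear_kernel (V : vectType k) (U : {vspace V}) (W : lmodType k) (g : {linear V -> W}) :
  exists2 U' : {vspace V}, (U' <= U)%VS & forall u, u \in U -> (u \in U') = (g u == 0).
Proof.
pose P n := `[< exists U' : {vspace V},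
  [/\ (U' <= U)%VS, forall u, u \in U' -> g u = 0 & \dim U' = n] >].
have P0 : exists n, P n.
  exists 0%N; apply/asboolP; exists 0%VS; rewrite sub0v dimv0; split=> // u.
  by rewrite memv0 => /eqP ->; rewrite linear0.
have Pb n : P n -> (n <= \dim U)%N by move=> /asboolP[U' [/dimvS + _ <-]].
have [n /asboolP[U' [U'U gU' dU']] nmax] := ex_maxnP P0 Pb.
exists U' => // u uU; apply/idP/eqP => [/gU'//|gu].
have uU' : (U' <= U' + <[u]>)%VS by apply: addvSl.
suff /eqP -> : U' == (U' + <[u]>)%VS by apply: (subvP (addvSr _ _)); apply: memv_line.
rewrite eqEdim uU' dU'; apply/nmax/asboolP; exists (U' + <[u]>)%VS; split=> //.
  by rewrite subv_add U'U -memvE.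
move=> v /memv_addP[x xU' [_ /vlineP[a ->] ->]].
by rewrite linearD linearZ /= gU'// gu scaler0 addr0.
Qed.

Lemma msum_linear s (V : vectType k) (l : {linear V -> A}) : linear (msum s \o l).
Proof.
move=> a u v; rewrite /= linearP msumD; congr (_ + _).
by rewrite /msum scaler_sumr; apply: eq_bigr => p _; rewrite -scalerAr -scalerAl.
Qed.

Lemma ideal_meet I J : two_sided_ideal I -> two_sided_ideal J ->
  (exists2 x : A, I x & x != 0) -> (exists2 x, J x & x != 0) ->
  exists2 x, (I `&` J) x & x != 0.
Proof.
move=> [lI IMr] idJ [x Ix x0] [y Jy y0]; have [_ _ IM] := lI.
have [a [ay Iay]] := ideal_essential prim (conj lI IMr) (ex_intro2 _ _ x Ix x0) y0.
by exists (a * y) => //; split=> //; have [[_ _ JM] _] := idJ; apply: JM.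
Qed.

(* Induction on [\dim U]: a sum of multiplications whose kernel on [l U] is proper
   and nonzero splits [U]; when there is none, every [l u] is a multiple of a
   fixed [l u1] by a scalar from a finite-dimensional subalgebra of the centre. *)
Lemma common_ideal (V : vectType k) (U : {vspace V}) (l : {linear V -> A}) :
  exists E : set A, [/\ two_sided_ideal E, exists2 x, E x & x != 0 &
    forall u, u \in U -> l u != 0 -> E `<=` principal_ideal (l u)].
Proof.
have [n] := ubnP (\dim U); elim: n => // n IH in U l *; rewrite ltnS => dU.
have idT : two_sided_ideal [set: A] by [].
(* In the splitting case [E1] serves the kernel [U']. The ideal [E2], found for the values of
   [msum s] on a complement of [U'], serves the other vectors, whose principal ideals contain these
   values. *)
have [[s [U' [U'U U'P U'0 U'N]]]|nsplit] := pselect (exists s (U' : {vspace V}),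
    [/\ (U' <= U)%VS, forall u, u \in U -> (u \in U') = (msum s (l u) == 0),
        U' != 0%VS & U' != U]).
  have capU' : (U :&: U')%VS = U' by apply/capv_idPr.
  have dim' := dimv_cap_compl U U'; rewrite capU' in dim'.
  have d0 : (0 < \dim U')%N by rewrite lt0n dimv_eq0.
  have d1 : (\dim U' < \dim U)%N.
    by rewrite ltn_neqAle dimvS// andbT; apply: contra U'N => /eqP E; rewrite eqEdim U'U E leqnn.
  have [|E1 [idE1 E10 E1P]] := IH U' l; first exact: leq_trans d1 dU.
  pose g : {linear V -> A} := HB.pack (msum s \o l) (GRing.isLinear.Build _ _ _ _ _ (msum_linear s l)).
  have [|E2 [idE2 E20 E2P]] := IH (U :\: U')%VS g.
    by rewrite -(ltn_add2l (\dim U')) dim' (leq_ltn_trans dU)// -{1}[n]add0n ltn_add2r.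
  exists (E1 `&` E2); split; [exact: two_sided_idealI|exact: ideal_meet|].
  move=> u uU lu; have [uU'|uU'] := boolP (u \in U').
    by apply: subset_trans (E1P _ uU' lu) => x [].
  have : u \in (U :\: U' + U :&: U')%VS by rewrite addv_diff_cap.
  rewrite capU' => /memv_addP[v vU [w wU' uE]].
  have wU : w \in U by apply: (subvP U'U).
  have w0 : msum s (l w) = 0 by apply/eqP; rewrite -U'P.
  have gE : g v = msum s (l u) by rewrite uE linearD msumD w0 addr0.
  apply: subset_trans (@subIsetr _ _ _) _; apply: subset_trans (E2P v vU _) _.
    by rewrite gE -U'P.
  by rewrite gE; apply: principal_ideal_sub; [apply: principal_ideal_two_sided|exists s].
(* Now a sum of multiplications that kills one nonzero [l u1] kills all of [l U], as [martindale]
   requires. *)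
have {}nsplit s u1 : u1 \in U -> l u1 != 0 -> msum s (l u1) = 0 ->
    forall u, u \in U -> msum s (l u) = 0.
  move=> u1U lu1 su1 u uU.
  pose g : {linear V -> A} := HB.pack (msum s \o l) (GRing.isLinear.Build _ _ _ _ _ (msum_linear s l)).
  have [U' U'U U'P] := linear_kernel U g.
  apply/eqP; rewrite -[_ == 0]U'P//.
  have [->//|U'N] := eqVneq U' U; case: nsplit; exists s, U'; split=> //.
  apply/eqP => U'0; have : u1 \in U' by rewrite U'P//; apply/eqP.
  by rewrite U'0 memv0 => /eqP u10; rewrite u10 linear0 eqxx in lu1.
have [[u1 u1U lu1]|no] := pselect (exists2 u, u \in U & l u != 0); last first.
  exists setT; split=> //; first by exists 1; rewrite ?oner_neq0.
  by move=> u uU lu; case: no; exists u.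
have /choice[f fP] : forall u, exists z, u \in U -> center Q z /\ emb (l u) = z * emb (l u1).
  move=> u; have [uU|_] := boolP (u \in U); last by exists 0.
  have [s su1|z cz zE] := @martindale (l u1) (l u) lu1; last by exists z.
  exact: (nsplit s u1).
pose F := [seq f b | b <- vbasis U].
have bU b : b \in (vbasis U : seq V) -> b \in U by apply: vbasis_mem.
have [|G [cG G1 FG GM]] := @finite_subalgebra F.
  by move=> _ /mapP[b /bU /fP[cb _] ->].
(* [s] clears the denominators of the whole span of [G]. If l u = w (l u1) is nonzero, then w^-1
   lies in that span and (l u1) s = (l u) (w^-1 s) belongs to the ideal of [l u]. *)
have [s rs sG] := common_denominator cG.
have u1s : l u1 * s != 0.
  by apply: contra lu1 => /eqP E; apply/eqP/rs.2; rewrite mul0r.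
exists (principal_ideal (l u1 * s)); split.
- exact: principal_ideal_two_sided.
- by exists (l u1 * s) => //; apply: principal_ideal_mem.
move=> u uU lu; apply: principal_ideal_sub; first exact: principal_ideal_two_sided.
pose w := \sum_i coord (vbasis U) i u *: f (vbasis U)`_i.
have wE : emb (l u) = w * emb (l u1).
  have -> : l u = \sum_i coord (vbasis U) i u *: l (vbasis U)`_i.
    rewrite {1}(coord_vbasis uU) linear_sum; apply: eq_bigr => i _.
    exact: linearZ.
  rewrite emb_sum mulr_suml; apply: eq_bigr => i _.
  have iU : (vbasis U)`_i \in U by apply: bU; rewrite mem_nth ?size_tuple.
  by rewrite embZ (fP _ iU).2 scalerAl.
have Gw : in_span G w.
  apply: in_span_sum => i _; apply/in_spanZ/FG/map_f.
  by rewrite mem_nth ?size_tuple.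
have w0 : w != 0.
  apply: contra lu => /eqP w0; apply/eqP/(@goldie_emb_inj _ _ Q).
  by rewrite wE w0 mul0r emb0.
have [w' Gw' ww'] := finite_subalgebra_inv cG G1 GM Gw w0.
have [d' dE] := denominators_span sG Gw'.
have -> : l u1 * s = l u * d'.
  apply: (@goldie_emb_inj _ _ Q); rewrite !embM wE dE !mulrA.
  have cw' := center_span cG Gw'.
  by rewrite -cw' !mulrA ww' mul1r.
have [_ M] := principal_ideal_two_sided (l u).
by apply: M; apply: principal_ideal_mem.
Qed.

End QuotientCenter.

(** * The prime spectrum *)

Section PrimeProducts.
Context (R : nzRingType).
Implicit Types (P Q : spec R) (l : seq (spec R)) (I J : set R).

Lemma spec_two_sided P : two_sided_ideal P.
Proof. by case: (spec_prime P). Qed.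

Lemma spec_left P : left_ideal P. Proof. exact: (spec_two_sided P).1. Qed.

Lemma spec_proper1 P : ~ spec_ideal P 1.
Proof. by case: (spec_prime P). Qed.

Lemma spec_inj P Q : P = Q :> set R -> P = Q.
Proof.
case: P Q => [P pP] [Q pQ] /= PQ; rewrite PQ in pP *.
by congr Spec; apply: Prop_irrelevance.
Qed.

Lemma spec_primeP P x y : (forall r, spec_ideal P (x * r * y)) -> spec_ideal P x \/ spec_ideal P y.
Proof.
move=> xy; have [[lP PMr] _ prP] := spec_prime P; have [_ _ PM] := lP.
have [] := prP _ _ (principal_ideal_two_sided x) (principal_ideal_two_sided y).
- move=> _ _ [s ->] [t ->]; rewrite /msum mulr_suml; apply: left_ideal_sum => // p _.
  rewrite mulr_sumr; apply: left_ideal_sum => // q _.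
  rewrite !mulrA; apply: (PMr); rewrite -!mulrA; apply: (PM).
  by rewrite (mulrA p.2) mulrA.
- by move=> h; left; apply: h; apply: principal_ideal_mem.
- by move=> h; right; apply: h; apply: principal_ideal_mem.
Qed.

(* Only the elementary products [x1 * ... * xn], not the ideal they generate. *)
Fixpoint prime_product l : set R :=
  if l is Q :: l' then [set x * y | x in Q & y in prime_product l'] else [set 1].

Lemma prime_product_notin l P : (forall Q, Q \in l -> ~ Q `<=` P) ->
  exists2 x, prime_product l x & ~ spec_ideal P x.
Proof.
elim: l => [|Q l IH] lP; first by exists 1 => //; apply: spec_proper1.
have [Q' Q'l|y ly yP] := IH; first by apply: lP; rewrite inE Q'l orbT.
have /existsNP[x /not_implyP[Qx xP]] := lP _ (mem_head Q l).
have [r xry] : exists r, ~ spec_ideal P (x * r * y).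
  apply: contrapT => /forallNP h.
  by case: (@spec_primeP P x y) => // r; apply: contrapT => /h.
exists (x * r * y) => //; exists (x * r); last by exists y.
by have [_ QM] := spec_two_sided Q; apply: QM.
Qed.

Lemma prime_product_sub l P : prime_product l `<=` P -> exists2 Q, Q \in l & Q `<=` P.
Proof.
move=> lP; apply: contrapT => no; have [|x /lP//] := @prime_product_notin l P.
by move=> Q Ql QP; apply: no; exists Q.
Qed.

Lemma prime_product_cat l1 l2 x : prime_product (l1 ++ l2) x ->
  exists y z, [/\ prime_product l1 y, prime_product l2 z & x = y * z].
Proof.
elim: l1 x => [|Q l1 IH] x /=; first by move=> l2x; exists 1, x; rewrite mul1r.
move=> [u Qu [v /IH[y [z [l1y l2z ->]]] <-]]; exists (u * y), z.
by split; rewrite ?mulrA//; exists u => //; exists y.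
Qed.

Hypothesis noeth : left_noetherian R.

(** Noetherian induction: a maximal counterexample [J] is not prime, so K1 K2 lies in [J] for two
    ideals not inside [J], and the lists for J + K1 and J + K2 concatenate. *)
Lemma finite_prime_product I : two_sided_ideal I ->
  exists l, (forall Q, Q \in l -> I `<=` Q) /\ prime_product l `<=` I.
Proof.
move=> idI; apply: contrapT => noI.
pose F := [set J | two_sided_ideal J /\
  ~ exists l, (forall Q, Q \in l -> J `<=` Q) /\ prime_product l `<=` J].
have [|J [[]]//|J [idJ noJ] Jmax] := noetherian_max noeth (F := F); first by exists I.
have [lJ JMr] := idJ; have [J0 JD JM] := lJ.
have J1 : ~ J 1 by move=> J1; apply: noJ; exists [::]; split=> // _ ->.
have sumsub K : two_sided_ideal K -> J `<=` [set x + y | x in J & y in K].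
  by move=> [[K0 _ _] _] x Jx; exists x => //; exists 0; rewrite ?addr0.
have sumdec K : two_sided_ideal K -> ~ K `<=` J -> exists l,
    (forall Q, Q \in l -> J `<=` Q) /\
    prime_product l `<=` [set x + y | x in J & y in K].
  move=> idK KJ; apply: contrapT => no; apply: KJ => y Ky.
  rewrite -(Jmax [set x + y | x in J & y in K]) => [||].
  - by exists 0 => //; exists y; rewrite ?add0r.
  - split; first exact: two_sided_ideal_add.
    move=> [l [Jl lJ']]; apply: no; exists l; split=> // Q /Jl.
    exact: subset_trans (sumsub _ idK).
  - exact: sumsub.
apply: noJ; have [prJ|] := pselect (prime_ideal J).
  exists [:: Spec prJ]; split=> [Q|x [y Jy [_ -> <-]]]; last by rewrite mulr1.
  by rewrite inE => /eqP ->.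
move=> nprJ; have [K1 [K2 [id1 id2 K12 K1J K2J]]] : exists K1 K2,
    [/\ two_sided_ideal K1, two_sided_ideal K2,
        forall x y, K1 x -> K2 y -> J (x * y), ~ K1 `<=` J & ~ K2 `<=` J].
  apply: contrapT => no; apply: nprJ; split=> // K1 K2 id1 id2 K12.
  have [|n1] := pselect (K1 `<=` J); first by left.
  have [|n2] := pselect (K2 `<=` J); first by right.
  by case: no; exists K1, K2.
have [l1 [Jl1 l1P]] := sumdec _ id1 K1J; have [l2 [Jl2 l2P]] := sumdec _ id2 K2J.
exists (l1 ++ l2); split.
  by move=> Q; rewrite mem_cat => /orP[/Jl1|/Jl2].
move=> _ /prime_product_cat[_ [_ [/l1P[x Jx [y Ky <-]] /l2P[x' Jx' [y' Ky' <-]] ->]]].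
rewrite mulrDr !mulrDl; apply: (JD); apply: (JD).
- exact: JM.
- exact: JM.
- exact: JMr.
- exact: K12.
Qed.

(** Only the order of the primes enters, and the index type [X] can be required to be finite or
    smaller than [k]. *)
Definition covers (X : Type) (h : X -> spec R) P :=
  (forall x, P `<` h x) /\ forall Q, P `<` Q -> exists x, h x `<=` Q.

Lemma spec_properW P Q : P `<=` Q -> Q <> P -> P `<` Q.
Proof. by move=> PQ nQP; split=> // QP; apply: nQP; apply/spec_inj/seteqP. Qed.

(** The closed set contains every prime above [P], so the primes strictly above must leave the open
    set, whose complement is cut out by [I]. *)
Lemma locally_closed_ideal P : locally_closed_set [set P] ->
  exists I, [/\ two_sided_ideal I, ~ I `<=` P & forall Q, P `<` Q -> I `<=` Q].
Proof.
move=> [U [C [oU /spec_closedP[J idJ CE] PE]]].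
have [I idI UE] : zariski_open U by [].
have [UP CP] : (U `&` C) P by rewrite -PE.
exists I; split=> //.
  move=> IP; have : (~` U) P by rewrite UE.
  exact.
move=> Q [PQ nQP]; have [//|nIQ] := pselect (I `<=` Q).
suff QP : [set P] Q by case: nQP; rewrite QP.
rewrite PE; split.
  by apply: contrapT => nU; apply: nIQ; have : (~` U) Q by []; rewrite UE.
by move: CP; rewrite CE /= => JP; apply: subset_trans PQ.
Qed.

Lemma locally_closedP P : locally_closed_set [set P] <->
  exists n (h : 'I_n -> spec R), covers h P.
Proof.
split=> [/locally_closed_ideal[I [idI IP PQI]]|[n [h [hP Ph]]]].
  have [P0 _ _] := spec_left P; have [[I0 _ _] _] := idI.
  (* Every prime over [J] contains [P], strictly because [I] is not inside [P]. *)
  pose J := [set x + y | x in I & y in P].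
  have idJ : two_sided_ideal J by apply: two_sided_ideal_add (spec_two_sided P).
  have [l [Jl lJ]] := finite_prime_product idJ.
  exists (size l), (tnth (in_tuple l)); split=> [i|Q PQ].
    have Jt := Jl _ (mem_tnth i (in_tuple l)).
    split=> [x Px|tP]; first by apply: Jt; exists 0 => //; exists x; rewrite ?add0r.
    apply: IP => x Ix; apply: tP; apply: Jt.
    by exists x => //; exists 0; rewrite ?addr0.
  have JQ : J `<=` Q.
    move=> _ [x /(PQI _ PQ) Qx [y /PQ.1 Qy <-]].
    by have [_ QD _] := spec_left Q; apply: QD.
  have [Q' Q'l Q'Q] := prime_product_sub (subset_trans lJ JQ).
  have /tnthP[i Q'E] : Q' \in in_tuple l by [].
  by exists i; rewrite -Q'E.
pose I := [set x | forall i, spec_ideal (h i) x].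
have idI : two_sided_ideal I.
  split; first split.
  - by move=> i; have [] := spec_left (h i).
  - by move=> x y Ix Iy i; have [_ D _] := spec_left (h i); apply: D.
  - by move=> r x Ix i; have [_ _ M] := spec_left (h i); apply: M.
  - by move=> x r Ix i; have [_ M] := spec_two_sided (h i); apply: M.
exists (~` [set Q : spec R | I `<=` Q]), [set Q : spec R | P `<=` Q]; split.
- by exists I => //; rewrite setCK.
- by apply/spec_closedP; exists P => //; apply: spec_two_sided.
apply/seteqP; split=> [_ ->|Q [/= nIQ PQ]].
  split=> //= IP.
  (* The product of the finitely many [h i] lies in their intersection [I] but not in [P]. *)
  have [x lx []] : exists2 x, prime_product (map h (enum 'I_n)) x & ~ spec_ideal P x.
    apply: prime_product_notin => _ /mapP[i _ ->].
    by have [] := hP i.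
  apply: IP => i; move: lx (mem_enum 'I_n i).
  elim: (enum _) x => //= j s IH _ [u ju [v sv <-]].
  rewrite inE => /orP[/eqP ->|/(IH _ sv)].
    by have [_ M] := spec_two_sided (h j); apply: M.
  by have [_ _ M] := spec_left (h i); apply: M.
apply: contrapT => QP; have [|i hiQ] := Ph Q; first exact: spec_properW.
by apply: nIQ => x Ix; apply: hiQ.
Qed.

End PrimeProducts.

(** * Order isomorphisms and homeomorphisms of spectra *)

Lemma covers_iso (R S : nzRingType) (f : spec R -> spec S) (X : Type) (h : X -> spec R) P :
  bijective f -> (forall P Q : spec R, P `<=` Q <-> f P `<=` f Q) ->
  covers h P -> covers (f \o h) (f P).
Proof.
move=> [g fK gK] fP [hP Ph]; split=> [x|Q].
  by have [PQ QP] := hP x; split; [apply/fP|move=> /fP].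
rewrite -(gK Q) => -[/fP PQ QP]; have [|x hx] := Ph (g Q); first by split=> // /fP.
by exists x; apply/fP.
Qed.

Lemma spec_order_isomorphic_sym (R S : nzRingType) :
  spec_order_isomorphic R S -> spec_order_isomorphic S R.
Proof.
move=> [f [g fK gK] fP]; exists g; first by exists f.
by move=> P Q; rewrite (fP (g P)) !gK.
Qed.

(** Inclusion is the specialization order of the Zariski topology, hence preserved by
    homeomorphisms. *)
Lemma spec_specialization (R : nzRingType) (P Q : spec R) :
  P `<=` Q <-> forall U : set (spec R), open U -> U Q -> U P.
Proof.
split=> [PQ U oU UQ|h].
  have [I idI UE] : zariski_open U by [].
  apply: contrapT => nUP; have : (~` U) P by []; rewrite UE /= => IP.
  by have : (~` U) Q by rewrite UE /=; apply: subset_trans PQ.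
apply: contrapT => PQ; apply: (h (~` [set Q : spec R | P `<=` Q])) => //.
by exists P; [apply: spec_two_sided|rewrite setCK].
Qed.

Lemma homeomorphic_order (R S : nzRingType) :
  homeomorphic (spec R) (spec S) -> spec_order_isomorphic R S.
Proof.
move=> [f [g [fK gK /continuousP fc /continuousP gc]]]; exists f; first by exists g.
move=> P Q; split=> /spec_specialization PQ; apply/spec_specialization => U oU UQ.
  exact: (PQ _ (fc _ oU)).
by have := PQ _ (gc _ oU); rewrite /preimage /= !fK; apply.
Qed.

(** * Cyclic left modules *)

Section ModuleQuotient.
Context (R : nzRingType) (L : set R) (lL : left_ideal L).

Definition lmod_equiv (x y : R) : bool := `[< L (x - y) >].

Let equiv_refl : reflexive lmod_equiv.
Proof. by move=> x; apply/asboolP; rewrite subrr; have [] := lL. Qed.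
Let equiv_sym : symmetric lmod_equiv.
Proof. by move=> x y; apply/asboolP/asboolP=> /(left_idealN lL); rewrite opprB. Qed.
Let equiv_trans : transitive lmod_equiv.
Proof.
move=> y x z /asboolP xy /asboolP yz; apply/asboolP.
by rewrite -(subrKA y); have [_ D _] := lL; apply: D.
Qed.

Canonical lmod_equiv_rel :=
  EquivRel lmod_equiv equiv_refl equiv_sym equiv_trans.

Definition lmod_quot : Type := {eq_quot lmod_equiv_rel}.
HB.instance Definition _ := Choice.on lmod_quot.
HB.instance Definition _ := Quotient.on lmod_quot.

Definition lmod_class (x : R) : lmod_quot := \pi x.

Lemma lmod_classP x y : lmod_class x = lmod_class y <-> L (x - y).
Proof.
split=> [xy|xy]; last exact/eqmodP/asboolP.
by apply/asboolP; move/eqP: xy; rewrite eqmodE.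
Qed.

Let classW (T : lmod_quot -> Prop) : (forall x, T (lmod_class x)) -> forall u, T u.
Proof. by move=> Tp u; rewrite -[u]reprK; apply: Tp. Qed.

Let reprP x : L (repr (lmod_class x) - x).
Proof. by apply/lmod_classP; rewrite /lmod_class reprK. Qed.

Definition lm_opp (u : lmod_quot) := lmod_class (- repr u).
Definition lm_add (u v : lmod_quot) := lmod_class (repr u + repr v).
Definition lm_scale (a : R) (u : lmod_quot) := lmod_class (a * repr u).

Let oppE x : lm_opp (lmod_class x) = lmod_class (- x).
Proof. by apply/lmod_classP; rewrite -opprD; apply: left_idealN. Qed.
Let addE x y : lm_add (lmod_class x) (lmod_class y) = lmod_class (x + y).
Proof. by apply/lmod_classP; rewrite opprD addrACA; have [_ D _] := lL; apply: D. Qed.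
Let scaleE a x : lm_scale a (lmod_class x) = lmod_class (a * x).
Proof. by apply/lmod_classP; rewrite -mulrBr; have [_ _ M] := lL; apply: M. Qed.

Let addA : associative lm_add.
Proof. by elim/classW=> x; elim/classW=> y; elim/classW=> z; rewrite !addE addrA. Qed.
Let addC : commutative lm_add.
Proof. by elim/classW=> x; elim/classW=> y; rewrite !addE addrC. Qed.
Let add0 : left_id (lmod_class 0) lm_add.
Proof. by elim/classW=> x; rewrite addE add0r. Qed.
Let addN : left_inverse (lmod_class 0) lm_opp lm_add.
Proof. by elim/classW=> x; rewrite oppE addE addNr. Qed.

HB.instance Definition _ := GRing.isZmodule.Build lmod_quot addA addC add0 addN.

Let scaleA a b u : lm_scale a (lm_scale b u) = lm_scale (a * b) u.
Proof. by elim/classW: u => x; rewrite !scaleE mulrA. Qed.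
Let scale1 : left_id 1 lm_scale.
Proof. by elim/classW=> x; rewrite scaleE mul1r. Qed.
Let scaleDr : right_distributive lm_scale +%R.
Proof.
by move=> a; elim/classW=> x; elim/classW=> y; rewrite /+%R/= addE !scaleE addE mulrDr.
Qed.
Let scaleDl u : {morph lm_scale^~ u : a b / a + b}.
Proof. by elim/classW: u => x a b /=; rewrite !scaleE [RHS]addE mulrDl. Qed.

HB.instance Definition _ := GRing.Zmodule_isLmodule.Build R lmod_quot
  scaleA scale1 scaleDr scaleDl.

Lemma lmod_quot_annihilator : annihilator lmod_quot = [set r | forall x, L (r * x)].
Proof.
have E r x : (r *: (lmod_class x : lmod_quot) = 0) <-> L (r * x).
  have -> : r *: (lmod_class x : lmod_quot) = lmod_class (r * x) by apply: scaleE.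
  split=> [/lmod_classP|Lrx]; first by rewrite subr0.
  by apply/lmod_classP; rewrite subr0.
apply/seteqP; split=> r /= h x; first exact/E/h.
by elim/classW: x => x; apply/E.
Qed.

Lemma lmod_quot_simple : ~ L 1 ->
  (forall x, ~ L x -> exists r, L (1 - r * x)) -> simple_module lmod_quot.
Proof.
move=> L1 Lmax; split.
  by exists (lmod_class 1); apply/eqP => /lmod_classP; rewrite subr0.
move=> N [N0 ND NM]; have [[u [Nu u0]]|no] := pselect (exists u, N u /\ u <> 0).
  right; apply/seteqP; split=> // v _; elim/classW: u Nu u0 => x Nx x0.
  have [|r Lr] := Lmax x; first by move=> Lx; apply: x0; apply/lmod_classP; rewrite subr0.
  elim/classW: v => y.
  suff -> : lmod_class y = (y * r) *: (lmod_class x : lmod_quot) by apply: NM.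
  rewrite [RHS]scaleE; apply/lmod_classP; rewrite -mulrA -{1}[y]mulr1 -mulrBr.
  by have [_ _ M] := lL; apply: M.
left; apply/seteqP; split=> [u Nu|_ -> //].
by apply: contrapT => u0; apply: no; exists u.
Qed.

End ModuleQuotient.

Section SpecQuotient.
Context (k : fieldType) (R : algType k) (P : spec R).
Local Notation A := (spec_quot P).
Local Notation proj := (spec_proj P).

Lemma spec_projW (T : A -> Prop) : (forall x, T (proj x)) -> forall u, T u.
Proof. by move=> Tp u; rewrite -[u]reprK; apply: Tp. Qed.

Lemma spec_proj_eq0 x : proj x = 0 <-> spec_ideal P x.
Proof. by have := spec_projP P x 0; rewrite subr0. Qed.

Lemma spec_quot_prime : prime_ring A.
Proof.
elim/spec_projW => x; elim/spec_projW => y xy.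
have [r|Px|Py] := @spec_primeP _ P x y; last 2 first.
- by left; apply/spec_proj_eq0.
- by right; apply/spec_proj_eq0.
by apply/spec_proj_eq0; rewrite !rmorphM; apply: xy.
Qed.

Lemma preimage_left_ideal (I : set A) : left_ideal I -> left_ideal (proj @^-1` I).
Proof.
move=> [I0 ID IM]; split; rewrite /preimage /=.
- by rewrite rmorph0.
- by move=> x y Ix Iy; rewrite rmorphD; apply: ID.
- by move=> r x Ix; rewrite rmorphM; apply: IM.
Qed.

Lemma preimage_ideal (I : set A) : two_sided_ideal I -> two_sided_ideal (proj @^-1` I).
Proof.
move=> [lI IMr]; split; first exact: preimage_left_ideal.
by move=> x r Ix; rewrite /preimage /= rmorphM; apply: IMr.
Qed.

Lemma image_ideal (I : set R) : two_sided_ideal I -> two_sided_ideal (proj @` I).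
Proof.
move=> [[I0 ID IM] IMr]; split; first split.
- by exists 0; rewrite ?rmorph0.
- by move=> _ _ [x Ix <-] [y Iy <-]; exists (x + y); rewrite ?rmorphD//; apply: ID.
- move=> r _ [x Ix <-]; elim/spec_projW: r => r.
  by exists (r * x); rewrite ?rmorphM//; apply: IM.
- move=> _ r [x Ix <-]; elim/spec_projW: r => r.
  by exists (x * r); rewrite ?rmorphM//; apply: IMr.
Qed.

Lemma preimage_inj (I J : set A) : proj @^-1` I = proj @^-1` J -> I = J.
Proof.
move=> IJ; apply/seteqP; split; elim/spec_projW => x h.
  by have : (proj @^-1` I) x by []; rewrite IJ.
by have : (proj @^-1` J) x by []; rewrite -IJ.
Qed.

Lemma spec_quot_noetherian : left_noetherian R -> left_noetherian A.
Proof.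
move=> noeth I lI II.
have [|n x|N NP] := noeth (fun n => proj @^-1` (I n)).
- by move=> n; apply: preimage_left_ideal.
- exact: II.
- by exists N => n Nn; apply: preimage_inj; apply: NP.
Qed.

Lemma proj_preimage_sub (Q : spec R) (I : set A) : P `<=` Q -> I `<=` proj @` Q ->
  proj @^-1` I `<=` Q.
Proof.
move=> PQ IQ y Iy; have [z Qz /spec_projP Pzy] := IQ _ Iy.
rewrite -[y](subKr z); apply: left_idealB Qz _; first exact: spec_left.
exact: PQ.
Qed.

End SpecQuotient.

(** * Locally closed, primitive and rational primes *)

Section SmallDimension.
Context (k : fieldType).

Definition finite_dim (V : lmodType k) := exists F : seq V, forall v, in_span F v.

(** A spanning family, rather than a basis, passes to quotients. *)
Definition uncountably_small_dim (V : lmodType k) :=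
  ~ embeds k nat /\ exists (X : Type) (h : X -> V), ~ embeds k X /\
    forall v, exists s : seq X, in_span (map h s) v.

Definition small_dim V := finite_dim V \/ uncountably_small_dim V.

Lemma in_span_seq (V : lmodType k) (s : seq V) (c : V -> k) :
  in_span s (\sum_(x <- s) c x *: x).
Proof. by apply: in_span_sum => x xs; apply/in_spanZ/in_span_mem. Qed.

(** When [k] is countable, an infinite basis would be at least as large as [k]. *)
Lemma dim_lt_card_small (V : lmodType k) : dim_lt_card V ->
  small_dim V /\ (embeds k nat -> finite_dim V).
Proof.
move=> [B [[_ Bspan] Bk nBk]].
have nkB : ~ ([set: k] #<= B) by move=> kB; move/negP: nBk; apply; rewrite card_eq_le Bk kB.
have fin : embeds k nat -> finite_dim V.
  move=> [f fI]; have [finB|] := pselect (finite_set B).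
    have /finite_seqP[s Bs] := finB.
    exists s => v; have [t [c [tB ->]]] := Bspan v.
    apply: (in_span_trans _ (in_span_seq t c)) => x /tB.
    by rewrite Bs => /in_span_mem.
  move/infiniteP => natB; case: nkB; apply: card_le_trans natB.
  have [|g] := (@injfunPex _ _ [set: k] [set: nat]).2; last exact: inj_card_le g.
  by exists f => // x y _ _; apply: fI.
split=> //; have [/fin|nkn] := pselect (embeds k nat); first by left.
right; split=> //; exists {x : V | x \in B}, val; split.
  move=> [f fI]; apply: nkB.
  have [|g] := (@injfunPex _ _ [set: k] B).2; last exact: inj_card_le g.
  exists (val \o f); first by move=> a _; apply/set_mem/(svalP (f a)).
  by move=> a b _ _ /val_inj/fI.
move=> v; have [t [c [tB ->]]] := Bspan v.
have [s <-] : exists s : seq {x : V | x \in B}, map val s = t.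
  elim: t tB => [|x t IH] tB; first by exists [::].
  have [y yt|s <-] := IH; first by apply: tB; rewrite inE yt orbT.
  have xB : x \in B by apply/mem_set/tB; rewrite mem_head.
  by exists (exist _ x xB :: s).
by exists s; apply: in_span_seq.
Qed.

Lemma finite_dim_image (V W : lmodType k) (f : {linear V -> W}) :
  (forall w, exists v, f v = w) -> finite_dim V -> finite_dim W.
Proof.
move=> fs [F FV]; exists (map f F) => w; have [v <-] := fs w.
exact: in_span_map.
Qed.

Lemma small_dim_image (V W : lmodType k) (f : {linear V -> W}) :
  (forall w, exists v, f v = w) -> small_dim V -> small_dim W.
Proof.
move=> fs [/(finite_dim_image fs)|[nk [X [h [nX hV]]]]]; first by left.
right; split=> //; exists X, (f \o h); split=> // w; have [v <-] := fs w.
by have [s /(in_span_map f)] := hV v; rewrite -map_comp; exists s.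
Qed.

(* Pigeonhole: the labels [g] and the supports of the [d a] take fewer than [|k|]
   values, so infinitely many [d a] lie in one finite-dimensional subspace. *)
Lemma dependent_family (V : lmodType k) (Y : Type) (g : k -> seq Y) (d : k -> V) :
  uncountably_small_dim V -> ~ embeds k Y ->
  exists w s c, [/\ uniq s, 0 \notin s, exists2 a, a \in s & c a != 0,
    forall a, a \in s -> g a = w & \sum_(a <- s) c a *: d a = 0].
Proof.
move=> [nk [X [h [nX hV]]]] nY; have [S dS] := choice (fun a => hV (d a)).
have [[w t] fib] := infinite_fibre (fun a => (g a, S a)) nk nY nX.
(* One element more than the spanning list, and one to spare for the removal of 0. *)
have [s [us ss sE]] := fib (size t).+2.
have sub a : a \in rem 0 s -> (g a, S a) = (w, t) by move=> /mem_rem /sE.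
have [|||c [cN sc]] := @in_span_dependent k V k (rem 0 s) d (map h t).
- exact: rem_uniq.
- rewrite size_map; have [z|z] := boolP (0 \in s).
    by rewrite size_rem// ss.
  by rewrite rem_id// ss.
- by move=> a /sub[_ <-].
exists w, (rem 0 s), c; split=> //; first exact: rem_uniq.
  by rewrite mem_rem_uniq// inE eqxx.
by move=> a /sub[].
Qed.

(** Allows labels in [seq unit]: constant ones, or natural numbers in unary. *)
Lemma not_embeds_unit : ~ embeds k unit.
Proof.
move=> [f fI]; have /eqP := oner_neq0 k; apply.
by apply: fI; case: (f 1); case: (f 0).
Qed.

Lemma finite_dim_powers (B : algType k) (F : seq B) (f : nat -> B) :
  (forall j, in_span F (f j)) -> exists p : {poly k},
    [/\ p != 0, (size p <= (size F).+1)%N & \sum_(j < size p) p`_j *: f j = 0].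
Proof.
move=> Ff; have [||j|c [[j jn cj] sc]] :=
  @in_span_dependent k B nat (index_iota 0 (size F).+1) f F => //.
- exact: iota_uniq.
- by rewrite size_iota subn0.
pose p := \poly_(j < (size F).+1) c j.
have pj : p`_j = c j by rewrite coef_poly; rewrite mem_index_iota /= in jn; rewrite jn.
exists p; split; [|exact: size_poly|].
  by apply: contraNneq cj => p0; rewrite -pj p0 coef0.
rewrite -(big_mkord xpredT (fun j => p`_j *: f j)).
rewrite -[RHS]sc [RHS](big_cat_nat _ (n := size p))//=; last exact: size_poly.
have -> : \sum_(size p <= i < (size F).+1) c i *: f i = 0.
  rewrite big_nat_cond big1// => i /andP[/andP[pi iF] _]; have := nth_default 0 pi.
  by rewrite coef_poly iF => ->; rewrite scale0r.
rewrite addr0; apply: eq_big_nat => i /andP[_ ip].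
by rewrite coef_poly (leq_trans ip)// size_poly.
Qed.

End SmallDimension.

(** * Amitsur's trick *)

Section Amitsur.
Context (k : fieldType) (A : algType k).
Hypotheses (noeth : left_noetherian A) (prim : prime_ring A).

(** A left inverse [u] of 1 - e is again of the form 1 - e' with e' in [E], so it has a left
    inverse, which can only be 1 - e. *)
Lemma quasi_inverse (E : set A) : two_sided_ideal E ->
  (forall e, E e -> exists u, u * (1 - e) = 1) ->
  forall e, E e -> exists u, is_inverse (1 - e) u.
Proof.
move=> [lE EMr] inv e Ee; have [u ue] := inv _ Ee; have [_ _ EM] := lE.
have uE : u = 1 - (- (u * e)).
  by rewrite opprK -{1}ue mulrBr mulr1 subrK.
have [|u' uu'] := inv (- (u * e)); first by apply: left_idealN lE _; apply: EM.
rewrite -uE in uu'; exists u; split=> //.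
suff -> : 1 - e = u' by [].
by rewrite -[RHS]mulr1 -[X in _ = _ * X]ue mulrA uu' mul1r.
Qed.

Lemma small_dim_algebraic (x : A) (v : k -> A) : small_dim A ->
  (forall a, a != 0 -> (x - a%:A) * v a = 1) ->
  exists2 p : {poly k}, p != 0 & horner_alg x p = 0.
Proof.
move=> [[F FA] _|small xv].
  have [p [p0 _ sp]] := finite_dim_powers (fun j => FA (x ^+ j)).
  by exists p => //; rewrite (horner_alg_sum x (leqnn _)).
have [_ [s [c [us s0 cN _ sc]]]] := dependent_family (fun=> [::]) v small (@not_embeds_unit k).
exists (resolvent_poly s c); first exact: resolvent_poly_neq0.
rewrite -[LHS]mulr1; apply: (resolvent_annihilates (d := v)) => // a sa.
by apply: xv; apply: contraNneq s0 => <-.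
Qed.

(* For [x] in [E] the resolvents [(x - a)^-1], [a != 0], outnumber the dimension,
   so [x] is algebraic; as [1 - e] is invertible for [e] in [E], it is nilpotent. *)
Lemma amitsur (E : set A) : small_dim A -> two_sided_ideal E ->
  (forall e, E e -> exists u, u * (1 - e) = 1) -> forall x, E x -> x = 0.
Proof.
move=> small idE inv; have [lE EMr] := idE; have [_ _ EM] := lE.
have EZ (a : k) x : E x -> E (a *: x) by rewrite -mulr_algl; apply: EM.
apply: (nil_left_ideal noeth prim lE) => x Ex.
have /choice[v vP] : forall a, exists v, a != 0 -> (x - a%:A) * v = 1.
  move=> a; have [->|a0] := eqVneq a 0; first by exists 0.
  have [u [ue _]] := quasi_inverse idE inv (EZ a^-1 _ Ex).
  exists (- a^-1 *: u) => _.
  have -> : x - a%:A = - a *: (1 - a^-1 *: x).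
    by rewrite scalerBr scalerA mulNr mulfV// scaleN1r opprK addrC scaleNr.
  by rewrite -scalerAl -scalerAr ue scalerA mulrNN mulfV// scale1r.
have [p0 p0N xp0] := small_dim_algebraic small vP.
(* Among the relations p(x) x^m = 0, one with [p] of least size has nonzero constant term, since a
   factor ['X] could move into x^m. Then p(x) is a scalar times 1 - e with e in [E], so it cancels
   and x^m = 0. *)
have ex : exists n, `[< exists (p : {poly k}) m,
    [/\ p != 0, horner_alg x p * x ^+ m = 0 & size p = n] >].
  by exists (size p0); apply/asboolP; exists p0, 0%N; rewrite xp0 mul0r.
have [n /asboolP[p [m [pN pw pn]]] nmin] := ex_minnP ex.
have [c pE] := divp_polyX p.
have [c0|c0] := eqVneq c 0.
  have qN : p %/ 'X != 0 by apply: contraNneq pN => E'; rewrite pE E' c0 mul0r addr0.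
  have : (n <= size (p %/ 'X)%R)%N.
    apply/nmin/asboolP; exists (p %/ 'X), m.+1; split=> //.
    by rewrite -[RHS]pw [in RHS]pE c0 addr0 rmorphM /= horner_algX exprS mulrA.
  have -> : n = (size (p %/ 'X)%R).+1 by rewrite -pn [in LHS]pE c0 addr0 size_mulX.
  by rewrite ltnn.
pose q := horner_alg x (p %/ 'X) * x.
have [|u ue] := inv (- c^-1 *: q); first by apply/EZ/EM.
exists m; rewrite -[LHS]mul1r -ue -mulrA.
suff -> : (1 - - c^-1 *: q) * x ^+ m = 0 by rewrite mulr0.
have pE' : horner_alg x p = c *: (1 - - c^-1 *: q).
  rewrite pE rmorphD rmorphM /= horner_algX horner_algC -/q scalerBr scalerA.
  by rewrite mulrN mulfV// scaleN1r opprK addrC.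
by move: pw; rewrite pE' -scalerAl => /eqP; rewrite scaler_eq0 (negPf c0) => /eqP.
Qed.

End Amitsur.

Section Implications.
Context (k : fieldType) (R : algType k).
Hypotheses (noeth : left_noetherian R) (small : small_dim R).
Implicit Types P Q : spec R.

Lemma spec_quot_finite P : finite_dim R -> finite_dim (spec_quot P).
Proof.
apply: (@finite_dim_image _ _ _ (spec_proj P)).
by elim/spec_projW => x; exists x.
Qed.

Lemma spec_quot_small P : small_dim (spec_quot P).
Proof.
apply: (@small_dim_image _ R _ (spec_proj P)) => //.
by elim/spec_projW => x; exists x.
Qed.

(** By [amitsur], some 1 - i with [i] in [I] has no left inverse modulo [P]. A maximal left ideal
    [L] containing 1 - i and [P] gives a simple module whose annihilator is a prime above [P]; were
    it larger than [P], it would contain [I], forcing [i] into [L]. *)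
Lemma locally_closed_primitive P : locally_closed P -> primitive P.
Proof.
move=> /locally_closed_ideal[I [idI IP PI]].
have [i0 Ii0 Pi0] : exists2 i, I i & ~ spec_ideal P i.
  by apply: contrapT => no; apply: IP => i Ii; apply: contrapT => Pi; apply: no; exists i.
have [e Ee eN] : exists2 e, (spec_proj P @` I) e & ~ exists u, u * (1 - e) = 1.
  apply: contrapT => no; apply: Pi0; apply/spec_proj_eq0.
  apply: (amitsur (spec_quot_noetherian noeth) (@spec_quot_prime _ _ P)
    (spec_quot_small P) (image_ideal P idI)); last by exists i0.
  by move=> e Ee; apply: contrapT => ne; apply: no; exists e.
have [i Ii iE] := Ee; subst e.
pose L0 := spec_proj P @^-1` [set r * (1 - spec_proj P i) | r in setT].
have lL0 : left_ideal L0 by apply/preimage_left_ideal/left_ideal_mul.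
have [|L [lL _ _]//|L [lL L0L L1] Lmax] := noetherian_max noeth
    (F := [set L | [/\ left_ideal L, L0 `<=` L & ~ L 1]]).
  exists L0; split=> // -[u _ uE]; apply: eN; exists u.
  by rewrite uE rmorph1.
have [L_0 LD LM] := lL.
have L1i : L (1 - i) by apply: L0L; exists 1; rewrite // mul1r rmorphB rmorph1.
have Li : ~ L i by move=> Li; apply: L1; rewrite -(subrK i 1); apply: LD.
have max x : ~ L x -> exists r, L (1 - r * x).
  move=> Lx; apply: contrapT => no.
  have L' : [set y + z | y in L & z in [set r * x | r in setT]] = L.
    apply: Lmax; last first.
      by move=> y Ly; exists y => //; exists 0; rewrite ?addr0//; exists 0; rewrite ?mul0r.
    split; first by apply: left_ideal_add => //; apply: left_ideal_mul.
      move=> y /L0L Ly; exists y => //.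
      by exists 0; rewrite ?addr0//; exists 0; rewrite ?mul0r.
    move=> [y Ly [_ [r _ <-] yr]]; apply: no; exists r.
    by rewrite -yr addrK.
  apply: Lx; rewrite -L'; exists 0 => //; exists x; rewrite ?add0r//.
  by exists 1; rewrite ?mul1r.
pose N := annihilator (lmod_quot lL).
have NE : N = [set r | forall x, L (r * x)] by apply: lmod_quot_annihilator.
have NL : N `<=` L by move=> x; rewrite NE => /(_ 1); rewrite mulr1.
have idN : two_sided_ideal N.
  rewrite NE; split; first split=> /=.
  - by move=> x; rewrite mul0r.
  - by move=> x y Nx Ny z; rewrite mulrDl; apply: LD.
  - by move=> r x Nx z; rewrite -mulrA; apply: LM.
  - by move=> x r Nx z; rewrite -mulrA.
have prN : prime_ideal N.
  split=> //; first by move=> /NL.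
  move=> I1 I2 [lI1 I1M] [lI2 I2M] I12.
  have [I2N|/existsNP[j /not_implyP[I2j]]] := pselect (I2 `<=` N); first by right.
  rewrite NE => /existsNP[x Ljx]; left=> y I1y z /=.
  have [r Lr] := max _ Ljx.
  rewrite -[y * z](subrK (y * z * (r * (j * x)))); apply: LD.
    by rewrite -{1}[y * z]mulr1 -mulrBr; apply: LM.
  apply: NL; apply: (I12 (y * z)); first exact: I1M.
  by have [_ _ I2Ml] := lI2; apply: I2Ml; apply: I2M.
exists (lmod_quot lL); split; first exact: lmod_quot_simple.
have PL : P `<=` L.
  move=> x Px; apply: L0L; exists 0 => //; rewrite mul0r.
  by apply/esym/spec_proj_eq0.
have PN : P `<=` N.
  by move=> x Px; rewrite NE => y; apply: PL; have [_ M] := spec_two_sided P; apply: M.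
apply: contrapT => PNN; apply: Li; apply: NL.
apply: (PI (Spec prN)) => //; split=> // NP.
by apply: PNN; apply/seteqP.
Qed.

(** [L] stands for the annihilator of a generator of a faithful simple module. Modulo [L], the
    element (z - a) d(a) is 1, so the d(a) imitate resolvents, and a linear relation between them
    makes the resolvent polynomial vanish at [z]. *)
Lemma maximal_left_ideal_algebraic (A : algType k) (L : set A) (Q : goldie_quotient_ring A) z :
  prime_ring A -> small_dim A -> left_ideal L ->
  (forall I, two_sided_ideal I -> (exists2 x, I x & x != 0) -> exists2 x, I x & L (1 - x)) ->
  (forall I, two_sided_ideal I -> I `<=` L -> forall x, I x -> x = 0) ->
  center Q z -> exists2 p : {poly k}, p != 0 & horner_alg z p = 0.
Proof.
move=> prim smallA lL Lmax Lcore cz.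
(* The products h(z) e, with [e] clearing all the listed denominators, form a two-sided ideal; once
   inside [L] it is zero. *)
have Lalg (h : {poly k}) qs (e : A) : regular_element e ->
    (forall q, q \in h :: qs -> denominators (horner_alg z q) e) ->
    (forall e y, (forall q, q \in h :: qs -> denominators (horner_alg z q) e) ->
      goldie_emb Q y = horner_alg z h * goldie_emb Q e -> L y) ->
    horner_alg z h = 0.
  move=> re eqs JL; pose J := [set y | exists2 e, (forall q, q \in h :: qs ->
    denominators (horner_alg z q) e) & goldie_emb Q y = horner_alg z h * goldie_emb Q e].
  have idq q : two_sided_ideal (denominators (horner_alg z q)).
    exact/denominators_ideal/center_horner.
  have ch := center_horner h cz.
  have [y yE] := eqs _ (mem_head _ _).
  suff y0 : y = 0 by apply: (emb_reg_eq0 re); rewrite -yE y0 emb0.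
  apply: (Lcore J); last by exists e.
    split; first split.
    - by exists 0; rewrite ?emb0 ?mulr0// => q _; have [[]] := idq q.
    - move=> x1 x2 [e1 h1 E1] [e2 h2 E2]; exists (e1 + e2).
        by move=> q qqs; have [[_ D _] _] := idq q; apply: D; [apply: h1|apply: h2].
      by rewrite !embD mulrDr E1 E2.
    - move=> r x1 [e1 h1 E1]; exists (r * e1).
        by move=> q qqs; have [[_ _ M] _] := idq q; apply: M; apply: h1.
      by rewrite !embM E1 !mulrA ch.
    - move=> x1 r [e1 h1 E1]; exists (e1 * r).
        by move=> q qqs; have [_ M] := idq q; apply: M; apply: h1.
      by rewrite !embM E1 mulrA.
  by move=> x1 [e1 h1 E1]; apply: JL E1.
have den (qs : seq {poly k}) : exists2 e : A, regular_element e &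
    forall q, q \in qs -> denominators (horner_alg z q) e.
  have [|e re eqs] := common_denominator (F := [seq horner_alg z q | q <- qs]).
    by move=> _ /mapP[q _ ->]; apply: center_horner.
  by exists e => // q qqs; apply/eqs/map_f.
case: smallA => [[F FA]|smallA].
  have [e re eqs] := den [seq 'X^j | j <- iota 0 (size F).+1].
  have /choice[f fP] : forall j : nat, exists a, (j <= size F)%N ->
      goldie_emb Q a = z ^+ j * goldie_emb Q e.
    move=> j; have [jF|_] := leqP j (size F); last by exists 0.
    have [|a aE] := eqs 'X^j; first by apply/map_f; rewrite mem_iota.
    by exists a; rewrite aE rmorphXn /= horner_algX.
  have [p [p0 pF sp]] := finite_dim_powers (fun j => FA (f j)).
  exists p => //; apply: (emb_reg_eq0 re).
  rewrite (horner_alg_sum z (leqnn _)) mulr_suml -[RHS](emb0 Q) -sp emb_sum.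
  apply: eq_bigr => j _; rewrite embZ fP ?scalerAl//.
  by rewrite -ltnS (leq_trans (ltn_ord j)).
(* Scalars are set aside so that no z - a vanishes. *)
have [[a za]|nz] := pselect (exists a : k, z = a%:A).
  exists ('X - a%:P); first by rewrite polyXsubC_eq0.
  by rewrite horner_algXsubC za subrr.
have /choice[d dP] : forall a : k, exists d, exists2 i, L (1 - i) &
    goldie_emb Q i = (z - a%:A) * goldie_emb Q d.
  move=> a; have cza : center Q (z - a%:A).
    by rewrite -horner_algXsubC; apply: center_horner.
  have [|i [d iE] Li] := Lmax _ (multiples_ideal cza); last by exists d, i.
  apply: multiples_neq0 => //; rewrite subr_eq0; apply/eqP => za.
  by apply: nz; exists a.
have [_ [s [c [us _ cN _ sc]]]] := dependent_family (fun=> [::]) d smallA (@not_embeds_unit k).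
exists (resolvent_poly s c); first exact: resolvent_poly_neq0.
pose g := \prod_(b <- s) ('X - b%:P) : {poly k}.
pose qs := g :: [seq \prod_(b <- rem a s) ('X - b%:P) | a <- s].
have [e re eqs] := den (resolvent_poly s c :: qs).
apply: (Lalg _ qs e) => // {re eqs}e y eqs yE.
have [v vE] : denominators (horner_alg z g) e by apply: eqs; rewrite !inE eqxx orbT.
(* Write g_a for the product of the X - b with b other than [a], and i = (z - a) d(a). Then u(a) =
   c(a) g_a(z) e (1 - i) lies in [L]. As g_a(z) e i = v d(a) with [v] independent of [a], the
   relation cancels these terms in the sum. *)
have /choice[u uP] : forall a, exists u, a \in s ->
    L u /\ goldie_emb Q u = c a *: (horner_alg z (\prod_(b <- rem a s) ('X - b%:P)) *
      goldie_emb Q e - goldie_emb Q (v * d a)).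
  move=> a; have [sa|_] := boolP (a \in s); last by exists 0.
  have [w wE] : denominators (horner_alg z (\prod_(b <- rem a s) ('X - b%:P))) e.
    by apply: eqs; rewrite !inE; apply/orP; right; apply/orP; right; apply/map_f.
  have [i Li iE] := dP a; have [_ _ LM] := lL.
  exists (c a *: (w * (1 - i))) => _; split.
    by rewrite -mulr_algl mulrA; apply: LM.
  rewrite embZ mulrBr mulr1; congr (_ *: _).
  rewrite (rmorphB (goldie_emb Q)) /=; congr (_ - _) => //.
  rewrite !embM wE vE iE -horner_algXsubC.
  rewrite -(mulrA _ (goldie_emb Q e)) (mulrA (goldie_emb Q e)).
  rewrite -(center_horner _ cz) !mulrA -rmorphM /=.
  by rewrite /g (big_rem a sa) /= mulrC.
have -> : y = \sum_(a <- s) u a; last by apply: left_ideal_sum => // a /uP[].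
apply: (@goldie_emb_inj _ _ Q); rewrite emb_sum.
rewrite [RHS](eq_big_seq _ (fun a sa => (uP a sa).2)).
under eq_bigr do rewrite scalerBr -embZ [X in _ - goldie_emb Q X]scalerAr.
rewrite big_split /= sumrN -emb_sum -mulr_sumr sc mulr0 emb0 subr0 yE.
rewrite /resolvent_poly rmorph_sum mulr_suml; apply: eq_bigr => a _.
by rewrite -mul_polyC rmorphM /= horner_algC -mulrA mulr_algl.
Qed.

Lemma primitive_rational P : primitive P -> rational P.
Proof.
move=> [M [[[m m0] Msimple] PM]].
have noethA := spec_quot_noetherian (P := P) noeth.
have primA := @spec_quot_prime _ _ P.
have [Q] := goldie noethA primA; exists Q => z cz.
have annm r : spec_ideal P r <-> forall x : M, r *: x = 0 by rewrite PM.
have Mgen (N : set M) : submodule N -> N m -> forall x, N x.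
  move=> sN Nm x; have [N0|->//] := Msimple N sN.
  by move: Nm m0; rewrite N0 => ->; rewrite eqxx.
pose L0 := [set r : R | r *: m = 0].
have lL0 : left_ideal L0.
  split; rewrite /L0 /= ?scale0r//; first by move=> x y; rewrite scalerDl => -> ->; rewrite addr0.
  by move=> r x rx; rewrite -scalerA rx scaler0.
pose L := spec_proj P @` L0.
have lL : left_ideal L.
  have [L0_0 L0D L0M] := lL0; split.
  - by exists 0; rewrite ?rmorph0.
  - by move=> _ _ [x Lx <-] [y Ly <-]; exists (x + y); rewrite ?rmorphD//; apply: L0D.
  - move=> r _ [x Lx <-]; elim/spec_projW: r => r.
    by exists (r * x); rewrite ?rmorphM//; apply: L0M.
have LP x : L (spec_proj P x) -> x *: m = 0.
  move=> [y ym /spec_projP/annm/(_ m)/eqP]; rewrite scalerBl subr_eq0 => /eqP <-.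
  exact: ym.
(* The vectors killed by [I] form a submodule; if it contains [m] it is all of [M], which is
   faithful over the quotient by [P]. *)
have Ikill (I : set (spec_quot P)) : two_sided_ideal I ->
    (forall r, I (spec_proj P r) -> r *: m = 0) -> forall x, I x -> x = 0.
  move=> [_ IMr] Im; elim/spec_projW => x Ix; apply/spec_proj_eq0/annm.
  suff h : forall y, [set y : M | forall r, I (spec_proj P r) -> r *: y = 0] y.
    by move=> y; apply: h.
  apply: Mgen; last by [].
  split=> /=.
  - by move=> r _; rewrite scaler0.
  - by move=> y y' h h' r Ir; rewrite scalerDr h// h'// addr0.
  - by move=> a y h r Ir; rewrite scalerA h// rmorphM; apply: IMr.
have [|||p p0 zp] := @maximal_left_ideal_algebraic _ L Q z primA (spec_quot_small P) lL; last 2 first.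
- done.
- by exists p => //; apply/eqP.
- move=> I idI [x Ix x0].
  (* The submodule I m is nonzero, hence contains m = r m, and 1 - r annihilates [m]. *)
  pose N := [set y : M | exists2 r, I (spec_proj P r) & y = r *: m].
  have [[I0 ID IM] IMr] := idI.
  have sN : submodule N.
    split.
    - by exists 0; rewrite ?rmorph0 ?scale0r.
    - move=> _ _ [r Ir ->] [s Is ->]; exists (r + s); last by rewrite scalerDl.
      by rewrite rmorphD; apply: ID.
    - move=> a _ [r Ir ->]; exists (a * r); last by rewrite scalerA.
      by rewrite rmorphM; apply: IM.
  have [N0|NT] := Msimple N sN; last first.
    have [r Ir mE] : N m by rewrite NT.
    exists (spec_proj P r) => //; exists (1 - r); last by rewrite rmorphB rmorph1.
    by rewrite /L0 /= scalerBl scale1r -mE subrr.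
  move/eqP: x0; case; apply: (Ikill I) Ix => // r Ir.
  have : N (r *: m) by exists r.
  by rewrite N0.
- by move=> I idI IL x; apply: (Ikill I) => // r /IL /LP.
Qed.

End Implications.

(** * Small covers *)

Section Covers.
Context (k : fieldType) (R : algType k).
Hypothesis noeth : left_noetherian R.
Implicit Types P Q : spec R.

Definition small_cover P :=
  exists (X : Type) (h : X -> spec R), ~ embeds k X /\ covers h P.

(** The list comes from a product of primes inside the preimage of the common ideal [E] of the span
    of [F]. If [Q] has an element outside [P] with image in this span, it contains that preimage,
    hence a prime of the list. *)
Lemma rational_finite_cover P (F : seq (spec_quot P)) : rational P ->
  exists l : seq (spec R), (forall Q, Q \in l -> P `<` Q) /\
    forall Q x, P `<` Q -> spec_ideal Q x -> ~ spec_ideal P x ->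
      in_span F (spec_proj P x) -> exists2 Q', Q' \in l & Q' `<=` Q.
Proof.
move=> [G Galg].
have noethA := spec_quot_noetherian (P := P) noeth.
have primA := @spec_quot_prime _ _ P.
pose l (c : 'rV[k]_(size F)) := \sum_i c 0 i *: F`_i.
have llin : linear l.
  move=> a c d; rewrite /l scaler_sumr -big_split; apply: eq_bigr => i _.
  by rewrite !mxE scalerDl scalerA.
pose L : {linear 'rV[k]_(size F) -> spec_quot P} :=
  HB.pack l (GRing.isLinear.Build _ _ _ _ _ llin).
have alg z : center G z -> exists2 p : {poly k}, p != 0 & horner_alg z p = 0.
  by move=> /Galg[p p0 /eqP zp]; exists p.
have [E [idE [x Ex x0] EP]] := common_ideal noethA primA alg fullv L.
have [l0 [El lE]] := finite_prime_product noeth (preimage_ideal idE).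
exists l0; split=> [Q Ql|Q y PQ Qy Py [c yE]].
  split=> [y Py|QP].
    apply: (El _ Ql); rewrite /preimage /=.
    have -> : spec_proj P y = 0 by apply/spec_proj_eq0.
    by have [[]] := idE.
  elim/spec_projW: x Ex x0 => x Ex /eqP; apply; apply/spec_proj_eq0/QP.
  exact: (El _ Ql).
apply: prime_product_sub; apply: subset_trans lE _.
refine (proj_preimage_sub PQ.1 _).
apply: subset_trans (EP c (memvf _) _) _.
  by rewrite [L c](_ : _ = spec_proj P y)//; apply/eqP => /spec_proj_eq0.
rewrite [L c](_ : _ = spec_proj P y)//; apply: principal_ideal_sub.
  exact: image_ideal (spec_two_sided Q).
by exists y.
Qed.

Lemma spec_proper_witness P Q : P `<` Q -> exists2 x, spec_ideal Q x & ~ spec_ideal P x.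
Proof.
move=> [_ QP]; apply: contrapT => no; apply: QP => x Qx.
by apply: contrapT => Px; apply: no; exists x.
Qed.

Lemma rational_locally_closed P : finite_dim R -> rational P -> locally_closed P.
Proof.
move=> /(spec_quot_finite P)[F FA] /(rational_finite_cover F)[l [lP Pl]].
apply/(locally_closedP noeth); exists (size l), (tnth (in_tuple l)); split=> [i|Q PQ].
  by apply: lP; apply: mem_tnth.
have [x Qx Px] := spec_proper_witness PQ.
have [Q' Q'l Q'Q] := Pl Q x PQ Qx Px (FA _).
have /tnthP[i Q'E] : Q' \in in_tuple l by [].
by exists i; rewrite -Q'E.
Qed.

Lemma rational_small_cover P : uncountably_small_dim R -> rational P -> small_cover P.
Proof.
move=> [nk [X [h [nX hR]]]] ratP.
have /choice[l lP] := fun s : seq X =>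
  rational_finite_cover (map (spec_proj P \o h) s) ratP.
(* One finite list for each finite part [s] of the spanning family, all put together. *)
exists {s : seq X & 'I_(size (l s))}, (fun u => tnth (in_tuple (l (tag u))) (tagged u)).
split.
  move=> [f fI].
  (* Pigeonhole gives two scalars with the same [s] and the same index, coded in unary by [nseq]. *)
  have [[s t] fib] := infinite_fibre (fun a => (tag (f a), nseq (tagged (f a)) tt))
    nk nX (@not_embeds_unit k).
  have [s2 [ab ss2 abE]] := fib 2%N; case: s2 ab ss2 abE => [|a [|b []]] // ab _ abE.
  have := abE b (mem_last a [:: b]); have := abE a (mem_head _ _).
  move: ab; rewrite /= inE andbT => /eqP ab [sa ta] [sb tb]; apply: ab; apply: fI.
  move: (f a) (f b) sa ta sb tb => [s1 i1] [s2 i2] /= s1E t1 s2E t2.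
  subst s1; subst s2; congr existT; apply: val_inj.
  by have := congr1 size (etrans t1 (esym t2)); rewrite !size_nseq.
split=> [[s i]|Q PQ]; first by apply: (lP s).1; apply: mem_tnth.
have [x Qx Px] := spec_proper_witness PQ.
have [s xs] := hR x; have [Q' Q'l Q'Q] := (lP s).2 Q x PQ Qx Px
  (eq_ind _ (fun t => in_span t _) (in_span_map (spec_proj P) xs) _ (esym (map_comp _ _ _))).
have /tnthP[i Q'E] : Q' \in in_tuple (l s) by [].
by exists (Tagged (fun s : seq X => 'I_(size (l s))) i); rewrite /= -Q'E.
Qed.

Lemma small_cover_rational P : uncountably_small_dim R -> small_cover P -> rational P.
Proof.
move=> small [X [h [nX [hP Ph]]]].
have noethA := spec_quot_noetherian (P := P) noeth.
have primA := @spec_quot_prime _ _ P.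
have [G] := goldie noethA primA; exists G => z cz.
suff [p p0 zp] : exists2 p : {poly k}, p != 0 & horner_alg z p = 0.
  by exists p => //; apply/eqP.
have [[a za]|nz] := pselect (exists a : k, z = a%:A).
  exists ('X - a%:P); first by rewrite polyXsubC_eq0.
  by rewrite horner_algXsubC za subrr.
(* [r] depends only on the word [w], so all the [a] that share a word share the numerator of the
   quotients (z - a)^-1 r. *)
have /choice[r rP] : forall w : seq X, exists r,
    prime_product (map h w) r /\ ~ spec_ideal P r.
  move=> w; have [|r wr Pr] := @prime_product_notin _ (map h w) P; last by exists r.
  by elim: w => //= x w IH Q; rewrite inE => /orP[/eqP ->|/IH//]; have [] := hP x.
have /choice[w wP] : forall a : k, exists w : seq X, exists d,
    goldie_emb G (spec_proj P (r w)) = (z - a%:A) * goldie_emb G d.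
  move=> a; have cza : center G (z - a%:A).
    by rewrite -horner_algXsubC; apply: center_horner.
  have idI := multiples_ideal cza.
  have [|x Ix /eqP x0] := multiples_neq0 cza.
    by rewrite subr_eq0; apply/eqP => za; apply: nz; exists a.
  have [l [Il lI]] := finite_prime_product noeth (preimage_ideal idI).
  have lP Q : Q \in l -> P `<` Q.
    move=> /Il IQ; split=> [y Py|QP].
      apply: IQ; rewrite /preimage /=.
      have -> : spec_proj P y = 0 by apply/spec_proj_eq0.
      by have [[]] := idI.
    elim/spec_projW: x Ix x0 => y Iy; apply; apply/spec_proj_eq0/QP.
    exact: IQ.
  (* Replacing each prime by a member of the cover inside it shrinks the set of products. *)
  have [w lw] : exists w : seq X, prime_product (map h w) `<=` prime_product l.
    elim: l {Il lI} lP => [|Q l IH] lP; first by exists [::].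
    have [Q' Q'l|w lw] := IH; first by apply: lP; rewrite inE Q'l orbT.
    have [v hvQ] := Ph Q (lP _ (mem_head _ _)).
    exists (v :: w) => _ [u hu [u' wu' <-]]; exists u; first exact: hvQ.
    by exists u' => //; apply: lw.
  by exists w; apply/lI/lw; have [] := rP w.
have [d dP] := choice wP.
have smallA : uncountably_small_dim (spec_quot P).
  have [nk [X' [h' [nX' hR]]]] := small.
  split=> //; exists X', (spec_proj P \o h'); split=> //; elim/spec_projW => x.
  by have [s /(in_span_map (spec_proj P))] := hR x; rewrite -map_comp; exists s.
have [w0 [s [c [us _ cN sw sc]]]] := dependent_family w d smallA nX.
exists (resolvent_poly s c); first exact: resolvent_poly_neq0.
apply: (center_mul_eq0 primA (x := spec_proj P (r w0))); first exact: center_horner.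
  apply: (resolvent_annihilates (d := fun a => goldie_emb G (d a))).
    by move=> a sa; rewrite -dP sw.
  under eq_bigr do rewrite -embZ.
  by rewrite -emb_sum sc emb0.
by apply/eqP => /spec_proj_eq0; have [] := rP w0.
Qed.

End Covers.

(** For uncountable [k], a small cover of a rational [P] travels to [R], where it makes [g P]
    rational, hence locally closed; the finite cover obtained there travels back. *)
Lemma dixmier_moeglin_transfer (k : fieldType) (R S : algType k) :
  left_noetherian R -> left_noetherian S -> dim_lt_card R -> dim_lt_card S ->
  spec_order_isomorphic R S -> dixmier_moeglin R -> dixmier_moeglin S.
Proof.
move=> noethR noethS /dim_lt_card_small[smallR _] /dim_lt_card_small[smallS finS] RS DM P.
have lc_prim := @locally_closed_primitive _ _ noethS smallS P.
have prim_rat := @primitive_rational _ _ noethS smallS P.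
suff rat_lc : rational P -> locally_closed P.
  by split; split=> // h; [apply/rat_lc/prim_rat|apply/lc_prim/rat_lc].
have [kn|nkn] := pselect (embeds k nat).
  exact: (rational_locally_closed noethS (finS kn)).
(* Over an uncountable field a finite spanning list also counts as smaller than [k], so both cases
   of [small_dim] merge. *)
have uncountable (V : lmodType k) : small_dim V -> uncountably_small_dim V.
  move=> [[F FV]|//]; split=> //; exists 'I_(size F), (fun i => F`_i); split.
    by move=> [f fI]; apply: nkn; exists (fun a => val (f a)) => a b /val_inj/fI.
  move=> v; exists (enum 'I_(size F)).
  apply: in_span_trans (FV v) => x xF; apply: in_span_mem.
  have iF : (index x F < size F)%N by rewrite index_mem.
  by apply/mapP; exists (Ordinal iF); rewrite ?mem_enum//= nth_index.
move=> /(rational_small_cover noethS (uncountable _ smallS))[X [h [nX hP]]].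
have [g gbij gP] := spec_order_isomorphic_sym RS.
have ratR : rational (g P).
  apply: (small_cover_rational noethR (uncountable _ smallR)).
  by exists X, (g \o h); split=> //; apply: covers_iso hP.
have [[_ prim_lcR] [_ rat_primR]] := DM (g P).
have /(locally_closedP noethR)[n [h' h'P]] := prim_lcR (rat_primR ratR).
have [f fK gK] := gbij.
apply/(locally_closedP noethS); exists n, (f \o h'); rewrite -(fK P).
apply: covers_iso h'P; first by exists g.
by move=> Q Q'; rewrite (gP (f Q)) !gK.
Qed.

Theorem theorem1p1 (k : fieldType) (R S : algType k)
    (noethR : left_noetherian R) (noethS : left_noetherian S)
    (dimR : dim_lt_card R) (dimS : dim_lt_card S) :
  (spec_order_isomorphic R S -> (dixmier_moeglin R <-> dixmier_moeglin S)) /\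
  (homeomorphic (spec R) (spec S) -> (dixmier_moeglin R <-> dixmier_moeglin S)).
Proof.
have iso : spec_order_isomorphic R S -> (dixmier_moeglin R <-> dixmier_moeglin S).
  move=> RS; split; first exact: dixmier_moeglin_transfer.
  exact/dixmier_moeglin_transfer/spec_order_isomorphic_sym.
by split=> // /homeomorphic_order.
Qed.
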